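(* Let $k\ge1$ and $g\ge0$ be integers. The mappings $\Psi^\circ_{g,k}:\mathbf{Q}^\circ_{g,k}\to\mathbf{LM}^\circ_{g,k}$ and $\Phi^\circ_{g,k}:\mathbf{LM}^\circ_{g,k}\to\mathbf{Q}^\circ_{g,k}$ are inverse of each other, and therefore are bijections between the sets $\mathbf{Q}^\circ_{g,k}$ and $\mathbf{LM}^\circ_{g,k}$. Moreover, if $(\mathbf m,[\mathbf l])=\Psi^\circ_{g,k}(\mathbf q,\mathbf x,D)$, then: 1. $|F(\mathbf q)|=|\mathbf E(\mathbf q)|/2=|\mathbf E(\mathbf m)|$; more precisely $|E_i(\mathbf q,\mathbf x,D)|=\deg_{\mathbf m}(f_i(\mathbf m))$ for $1\le i\le k$. 2. $|V(\mathbf q)|=|V(\mathbf m)|+k$. 3. For every $1\le i\le k$ and $d\ge1$, $$\Big|\big\{e\in E_i(\mathbf q,\mathbf x,D):d_{\mathbf q}(e^-,x_i)=d\big\}\Big|=\Big|\big\{e\in f_i(\mathbf m):\mathbf l(e)-\min_{e'\in f_i(\mathbf m)}\mathbf l(e')+1=d\big\}\Big|$$ (the right-hand side does not depend on the choice of $\mathbf l\in[\mathbf l]$).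
   Context: Maps. A map of genus $g$ is a finite connected graph (loops and multiple edges allowed, non-empty edge set) embedded in the compact connected oriented surface without boundary of genus $g$ such that all faces are simply connected, considered up to orientation-preserving homeomorphisms (which must preserve any additional marked structure). $V,\mathbf E,E,F$ denote the sets of vertices, unoriented edges, half-edges (oriented edges) and faces. A half-edge $e$ has origin $e^-$, target $e^+$ and reversal $\bar e$. A half-edge is incident to the face on its left; $e\in f$ means $e$ is incident to $f$. The degree $\deg_{\mathbf m}(f)$ is the number of half-edges incident to $f$. $\sigma$ is the permutation of $E$ listing cyclically, in counterclockwise order, the half-edges going out of each vertex; $\alpha(e)=\bar e$; $\varphi=\sigma^{-1}\alpha^{-1}$, whose cycles list the half-edges incident to each face in counterclockwise order around the face. The corner incident to $e$ is the angular sector at $e^-$ between $e$ and $\sigma(e)$ (it lies in the face to the left of $e$). $d_{\mathbf q}$ is the graph distance. A quadrangulation is a map whose faces all have degree 4; bipartite means properly vertex 2-colorable. The set $\mathbf Q^\circ_{g,k}$: triples $(\mathbf q,\mathbf x,D)$ where $\mathbf q$ is an unrooted bipartite quadrangulation of genus $g$, $\mathbf x=(x_1,\dots,x_k)\in V(\mathbf q)^k$, and $D=[d_1,\dots,d_k]$ is an element of $\mathbb Z^k$ modulo addition of a common integer (a delay vector) with $|d_i-d_j|<d_{\mathbf q}(x_i,x_j)$ for all $i\ne j$ and $d_{\mathbf q}(x_i,x_j)+d_i-d_j$ an even non-negative integer for all $i,j$. For $k=1$, $D=[0]$. Tiles: given $(\mathbf q,\mathbf x,D)\in\mathbf Q^\circ_{g,k}$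 and a representative $(d_1,\dots,d_k)$ of $D$, set $\mathbf l(x)=\min_i(d_i+d_{\mathbf q}(x,x_i))$; adjacent vertices have labels differing by exactly 1. Let $E_{1/2}$ be the orientation of the edges of $\mathbf q$ (one half-edge per edge) such that $\mathbf l(e^+)=\mathbf l(e^-)-1$. For $e\in E_{1/2}$ consider the maximal path of half-edges of $E_{1/2}$ starting with $e$ and turning as much to the left as possible: after arriving at a vertex it takes the first outgoing half-edge of $E_{1/2}$ met in clockwise order around the vertex. This path ends at some source $x_i$, and $E_i(\mathbf q,\mathbf x,D)$ is the set of $e\in E_{1/2}$ whose path ends at $x_i$. The set $\mathbf{LM}^\circ_{g,k}$: pairs $(\mathbf m,[\mathbf l])$ where $\mathbf m$ is an unrooted map of genus $g$ with $k$ faces indexed $f_1(\mathbf m),\dots,f_k(\mathbf m)$, and $[\mathbf l]$ is the class, modulo an additive constant in $\mathbb Z$, of a labeling $\mathbf l:V(\mathbf m)\to\mathbb Z$ such that $|\mathbf l(x)-\mathbf l(y)|\le1$ for adjacent $x,y$. For a half-edge $e$, $\mathbf l(e):=\mathbf l(e^-)$. The map $\Psi^\circ_{g,k}$: given $(\mathbf q,\mathbf x,D)$, choose a representative $(d_1,\dots,d_k)$ of $D$ and label $V(\mathbf q)$ by $\mathbf l(x)=\min_{1\le i\le k}(d_i+d_{\mathbf q}(x,x_i))$, $x\in V(\mathbf q)$. Reading the labels counterclockwise around a face from a vertex of lowest label one finds either $l,l+1,l+2,l+1$ (simple face) or $l,l+1,l,l+1$ (confluent face). In each simple face add an edge linking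 the vertex (corner) of highest label to its successor in clockwise order around the face (splitting the face into a face of degree 4 and a face of degree 2); in each confluent face add an edge linking the two vertices (corners) of highest label. The added edges alone form an embedded graph $\mathbf m$ with vertex set $V(\mathbf q)\setminus\{x_1,\dots,x_k\}$; it is a map, each of whose faces contains exactly one $x_i$, and is indexed as $f_i(\mathbf m)$ accordingly. Then $\Psi^\circ_{g,k}(\mathbf q,\mathbf x,D)=(\mathbf m,[\mathbf l])$ with $\mathbf l$ restricted to $V(\mathbf m)$. The map $\Phi^\circ_{g,k}$: given $(\mathbf m,[\mathbf l])$, choose $\mathbf l\in[\mathbf l]$, add a vertex $x_i$ inside each face $f_i(\mathbf m)$ and set $\mathbf l(x_i)=\min_{e\in f_i(\mathbf m)}\mathbf l(e)-1$. The successor of $e\in f_i(\mathbf m)$ is $s(e)=x_i$ if $\mathbf l(e)=\mathbf l(x_i)+1$, and otherwise $s(e)=\varphi^{m(e)}(e)$ with $m(e)=\min\{m\ge1:\mathbf l(\varphi^m(e))=\mathbf l(e)-1\}$. For every $e\in E(\mathbf m)$ draw an edge inside its face between the corner incident to $e$ and the corner incident to $s(e)$ (or the vertex $x_i$), without crossings, then delete the edges of $\mathbf m$. The result is a bipartite quadrangulation $\mathbf q$, and $\Phi^\circ_{g,k}(\mathbf m,[\mathbf l])=(\mathbf q,(x_1,\dots,x_k),[\mathbf l(x_1),\dots,\mathbf l(x_k)])\in\mathbf Q^\circ_{g,k}$. *)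

(* Defs.v *)
From mathcomp Require Import all_boot all_order all_algebra.

Set Implicit Arguments.
Unset Strict Implicit.
Unset Printing Implicit Defensive.

Import Order.TTheory GRing.Theory Num.Theory.
Local Open Scope ring_scope.

(* The head is the default of the fold, so no junk value enters the minimum of
   a non-empty list; the minimum of the empty list is 0. *)
Definition minseq (s : seq int) : int := foldr Num.min (head 0 s) s.

(* Maps are encoded combinatorially: an embedded graph with simply connected
   faces is determined, up to orientation-preserving homeomorphism, by the
   permutations sigma and alpha of its half-edges, up to relabeling of the
   half-edges.  The record only holds the data; see [is_map]. *)
Record cmap := CMap {
  dart :> finType;
  sigma : dart -> dart;
  alpha : dart -> dart }.

Section Maps.
Variable m : cmap.
Implicit Types (e : m) (u v : {set m}).

(* sigma^-1 alpha^-1, alpha being an involution. *)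
Definition phi e : m := finv (@sigma m) (alpha e).

(* A vertex is identified with the set of half-edges going out of it, a face
   with the set of half-edges incident to it, an edge with the pair of its
   half-edges. *)
Definition org e : {set m} := [set e' | fconnect (@sigma m) e e'].
Definition tgt e : {set m} := org (alpha e).
Definition face_of e : {set m} := [set e' | fconnect phi e e'].

Definition vertices : {set {set m}} := [set org e | e : m].
Definition faces : {set {set m}} := [set face_of e | e : m].
Definition edges : {set {set m}} := [set [set e; alpha e] | e : m].

Definition is_map : Prop :=
  [/\ injective (@sigma m),
      involutive (@alpha m),
      forall e, alpha e != e,
      inhabited m
    & forall e e', connect (relU (frel (@sigma m)) (frel (@alpha m))) e e'].

(* Euler's formula #V - #E + #F = 2 - 2g. *)
Definition is_map_of_genus (g : nat) : Prop :=
  is_map /\ (#|vertices| + #|faces| + 2 * g = #|edges| + 2)%N.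

Definition adj u v : bool := [exists e, (org e == u) && (tgt e == v)].

Definition walk (n : nat) u v : bool :=
  [exists p : n.-tuple {set m}, path adj u p && (last u p == v)].

(* A shortest walk visits each vertex at most once, so lengths below the number
   of vertices suffice; that number is a default value, which is not attained
   when u and v are vertices of a map. *)
Definition dist u v : nat :=
  \big[minn/#|vertices|]_(n < #|vertices| | walk n u v) n.

Definition is_quadrangulation : Prop :=
  forall f, f \in faces -> #|f| = 4%N.

Definition is_bipartite : Prop :=
  exists c : {set m} -> bool, forall e, c (org e) != c (tgt e).

End Maps.

Definition is_cmap_iso (m m' : cmap) (h : m -> m') : Prop :=
  [/\ bijective h,
      forall e, h (sigma e) = sigma (h e)
    & forall e, h (alpha e) = alpha (h e)].

(* A map with k marked vertices and a representative of a delay vector; the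
   class modulo constants is taken in [pointed_iso]. *)
Record pointed_map (k : nat) := PointedMap {
  pt_cmap :> cmap;
  src : 'I_k -> {set pt_cmap};
  delay : 'I_k -> int }.

Definition pointed_iso (k : nat) (q q' : pointed_map k) : Prop :=
  exists h : q -> q',
    [/\ is_cmap_iso h,
        forall i, src q' i = h @: src q i
      & exists c : int, forall i, delay q' i = delay q i + c].

Definition is_Q (g k : nat) (q : pointed_map k) : Prop :=
  [/\ is_map_of_genus q g, is_quadrangulation q, is_bipartite q
    & [/\ forall i, src q i \in vertices q,
          forall i j, i != j ->
            `|delay q i - delay q j| < (dist (src q i) (src q j))%:Z
        & forall i j,
            let z := (dist (src q i) (src q j))%:Z + delay q i - delay q j in
            (2 %| z)%Z /\ 0 <= z]].

(* A map with k indexed faces and a representative of a labeling of its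
   vertices modulo constants (the class is taken in [labeled_iso]).  A function l
   on vertices is encoded by the function e |-> l (org e) on half-edges, which
   is an arbitrary function invariant under sigma. *)
Record labeled_map (k : nat) := LabeledMap {
  lb_cmap :> cmap;
  fac : 'I_k -> {set lb_cmap};
  lab : lb_cmap -> int }.

Definition labeled_iso (k : nat) (m m' : labeled_map k) : Prop :=
  exists h : m -> m',
    [/\ is_cmap_iso h,
        forall i, fac m' i = h @: fac m i
      & exists c : int, forall e, lab (h e) = lab e + c].

Definition is_LM (g k : nat) (m : labeled_map k) : Prop :=
  [/\ is_map_of_genus m g,
      injective (fac m), [set fac m i | i : 'I_k] = faces m
    & (forall e : m, lab (sigma e) = lab e) /\
      (forall e : m, `|lab e - lab (alpha e)| <= 1)].

(* The elements of both sets are isomorphism classes. *)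
Definition Qo (g k : nat) : Type :=
  {A : pointed_map k -> Prop | exists2 q, is_Q g q & A = pointed_iso q}.

Definition LMo (g k : nat) : Type :=
  {B : labeled_map k -> Prop | exists2 m, is_LM g m & B = labeled_iso m}.

Section Psi.
Variables (k : nat) (q : pointed_map k).
Implicit Types e c : q.

Definition vlabel (v : {set q}) : int :=
  minseq [seq delay q i + (dist v (src q i))%:Z | i : 'I_k].

Definition elabel e : int := vlabel (org e).

(* The labels read counterclockwise around a face, from the corner of e. *)
Definition simple_at e : bool :=
  [seq elabel e' - elabel e | e' <- [:: phi e; phi (phi e); phi (phi (phi e))]]
    == [:: 1; 2; 1].

Definition confluent_at e : bool :=
  [seq elabel e' - elabel e | e' <- [:: phi e; phi (phi e); phi (phi (phi e))]]
    == [:: 1; 0; 1].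

(* The half-edge e stands for the corner incident to it.  In a simple face the
   corner phi (phi e) of highest label is linked to its clockwise successor
   phi e, in a confluent face the two corners of highest label are linked. *)
Definition chord c c' : bool :=
  [exists e, simple_at e &&
     ([set c; c'] == [set phi e; phi (phi e)])] ||
  [exists e, confluent_at e &&
     ([set c; c'] == [set phi e; phi (phi (phi e))])].

Definition chorded c : bool := [exists c', chord c c'].

(* At most one added edge ends in a given corner of q, so the half-edges of the
   new map are identified with the corners of q from which they start. *)
Definition psi_dart : finType := {c : q | chorded c}.

(* The new half-edges in counterclockwise order around a vertex of q. *)
Definition psi_sigma (c : psi_dart) : psi_dart :=
  next (pmap insub (orbit (@sigma q) (val c))) c.

Definition psi_alpha (c : psi_dart) : psi_dart :=
  odflt c [pick c' : psi_dart | chord (val c) (val c')].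

Definition psi_cmap : cmap := CMap psi_sigma psi_alpha.

(* The region left of e is the one, among those cut out by the edges of q and
   the added edges, that has the side of e in its boundary.  Two such regions
   lie in the same face of the new map when they can be joined by crossing
   edges of q only, or, inside a face of q, by passing along a corner that is
   not the end of an added edge. *)
Definition same_region e e' : bool :=
  [|| e' == alpha e,
      (e' == phi e) && ~~ chorded e'
    | (e == phi e') && ~~ chorded e].

(* The added half-edge starting from the corner c of q has on its left the
   region left of the half-edge preceding c around the face; the face to which
   it is incident contains x_i when this region is connected to a corner of
   x_i. *)
Definition psi_fac (i : 'I_k) : {set psi_dart} :=
  [set c | [exists e, [&& phi e == val c :> q
    & [exists e', (e' \in src q i) && connect same_region e e']]]].

Definition psi_lab (c : psi_dart) : int := elabel (val c).

Definition psi : labeled_map k := @LabeledMap k psi_cmap psi_fac psi_lab.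

Definition Ehalf : {set q} := [set e | vlabel (tgt e) == vlabel (org e) - 1].

(* The orbit of sigma^-1 from alpha e lists the half-edges going out of the
   target of e in clockwise order, from the edge just followed. *)
Definition lstep e e' : bool :=
  ohead [seq h <- orbit (finv (@sigma q)) (alpha e) | h \in Ehalf] == Some e'.

Definition Ei (i : 'I_k) : {set q} :=
  [set e in Ehalf | [exists e', [&& connect lstep e e',
     ~~ [exists e'', lstep e' e''] & tgt e' == src q i]]].

End Psi.

Definition face_min (k : nat) (m : labeled_map k) (f : {set m}) : int :=
  minseq [seq lab e | e in f].

Section Phi.
Variables (k : nat) (m : labeled_map k).
Implicit Types e c : m.

(* [None] stands for the vertex added inside the face of e. *)
Definition succ e : option m :=
  if lab e == face_min (face_of e) then None
  else ohead [seq e' <- orbit (@phi m) e | lab e' == lab e - 1].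

(* The edge drawn from the corner of e has half-edges (e, true), oriented from
   e to its successor, and (e, false). *)
Definition phi_dart : finType := (m * bool)%type.

Definition phi_alpha (h : phi_dart) : phi_dart := (h.1, ~~ h.2).

(* The new half-edges starting in the corner of e, in counterclockwise order.
   Seen from that corner, the other corners of the face appear
   counterclockwise in the order of phi; since the edges do not cross, the
   edge to the successor of e comes before those from its predecessors.  (When
   e is the only corner of minimal label of its face, this is the position of
   the added vertex for which all new faces have degree 4.) *)
Definition corner_darts e : seq phi_dart :=
  (e, true) :: [seq (e', false) | e' <- orbit (@phi m) e & succ e' == Some e].

(* The new half-edges in counterclockwise order around the origin of e, resp.
   around the vertex added inside the face of e. *)
Definition around_old e : seq phi_dart :=
  flatten [seq corner_darts c | c <- orbit (@sigma m) e].

Definition around_new e : seq phi_dart :=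
  [seq (e', false) | e' <- orbit (@phi m) e & succ e' == None].

Definition phi_sigma (h : phi_dart) : phi_dart :=
  let: (e, b) := h in
  if b then next (around_old e) h
  else if succ e is Some c then next (around_old c) h
  else next (around_new e) h.

Definition phi_cmap : cmap := CMap phi_sigma phi_alpha.

Definition phi_src (i : 'I_k) : {set phi_dart} :=
  [set (e, false) | e in fac m i & succ e == None].

Definition phi_delay (i : 'I_k) : int := face_min (fac m i) - 1.

Definition phi_pointed : pointed_map k :=
  @PointedMap k phi_cmap phi_src phi_delay.

End Phi.

(* The constructions on isomorphism classes.  They yield a single class only
   when all representatives have isomorphic images. *)
Definition Psio (k : nat) (A : pointed_map k -> Prop) : labeled_map k -> Prop :=
  fun m => exists2 q, A q & labeled_iso (psi q) m.

Definition Phio (k : nat) (B : labeled_map k -> Prop) : pointed_map k -> Prop :=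
  fun q => exists2 m, B m & pointed_iso (phi_pointed m) q.

(* Main.v *)
(* Identify the half-edges of m with the descending half-edges of q: the corner
   of c carries an added edge exactly when sigma c descends.  Then the involution
   of m exchanges the two ascending half-edges of each face of q (seen from their
   reversals), and the vertex permutation of m is the first return of that of q
   to the descending half-edges.  [linked] records this correspondence, for any
   labeling of q whose local minima are the points x_i with labels d_i.

   Reading one face of q shows that a step of the face permutation of m changes
   the label by 1, 0 or -1, a step of -1 being one step of the leftmost
   descending path.  By induction, the successor of a half-edge in its face of m
   is the next half-edge of its leftmost path, and the corners of minimal label
   of a face of m turn once around a local minimum of q.  So the faces of m
   correspond to the x_i, connectedness and Euler's formula pass from one map to
   the other, and the faces of q can be written in terms of (m, l).

   Finally psi q is linked to q, m is linked to phi_pointed m, and in a linked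
   pair each member determines the other up to isomorphism (the labels of q are
   forced by those of the local minima), so that the two constructions are
   inverse of each other. *)
Require Import Defs.
From mathcomp Require Import all_boot all_order all_algebra zify.
From mathcomp Require boolp.

Set Implicit Arguments.
Unset Strict Implicit.
Unset Printing Implicit Defensive.

Import Order.TTheory GRing.Theory Num.Theory.
Local Open Scope ring_scope.

(** * First points of an orbit *)

(** The link mentions no distances, and it describes vertex permutations by first returns instead of
    cyclic lists. An explicit comparison of [psi (phi_pointed m)] with m, which would require the
    distances of the new quadrangulation, is thus avoided: its labels are determined by their local
    minima alone. Successors and leftmost paths agree because labels drop by at most 1 along a face
    of m. The first value below a level is then exactly one less, and the stretches between returns
    to a level nest like parentheses; in q, a simple face opens such a stretch with its first ascent
    and closes it with its last side. The obstacle in each transfer is that the sources are vertices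
    of q but not of m. They are handled through the corners of minimal label: the half-edges of q
    pointing at one local minimum come from a single face of m. *)

Section First.
Variables (T : finType) (f : T -> T).
Implicit Types (P : pred T) (x y : T).

Definition first P x := ohead [seq y <- orbit f x | P y].

Lemma first_some P x y : first P x = Some y ->
  exists n, [/\ y = iter n f x, P y & forall j, (j < n)%N -> ~~ P (iter j f x)].
Proof.
rewrite /first /orbit; move: (order f x) => n; elim: n x => [|n IHn] x //=.
case: ifP => [Px [<-]|nPx /IHn [i [-> Py lt_i]]]; first by exists 0%N.
exists i.+1; split; rewrite ?iterSr // => -[|j] lt_ji; first by rewrite nPx.
by rewrite iterSr lt_i.
Qed.

Lemma first_none P x : first P x = None -> forall n, ~~ P (iter n f x).
Proof.
rewrite /first => none n; apply/negP => Pn.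
have : iter n f x \in [seq y <- orbit f x | P y].
  by rewrite mem_filter Pn -fconnect_orbit fconnect_iter.
by case: (filter _ _) none.
Qed.

Lemma some_first P x n : P (iter n f x) ->
  (forall j, (j < n)%N -> ~~ P (iter j f x)) -> first P x = Some (iter n f x).
Proof.
move=> Pn lt_n; case E: (first P x) => [y|]; last first.
  by rewrite (negPf (first_none E n)) in Pn.
have [i [Dy Py lt_i]] := first_some E.
case: (ltngtP i n) => [/lt_n|/lt_i|<-]; last by rewrite Dy.
  by rewrite -Dy Py.
by rewrite Pn.
Qed.

Lemma first_rec P x :
  first P x = if P x then Some x else first P (f x).
Proof.
case: ifPn => [Px|nPx]; first by rewrite (@some_first _ _ 0).
case E: (first P (f x)) => [y|].
  have [n [Dy Py lt_n]] := first_some E; rewrite Dy -iterSr.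
  apply: some_first => [|[|j] lt_j //]; first by rewrite iterSr -Dy.
  by rewrite iterSr lt_n.
case E': (first P x) => [y|//].
have [[|n] [Dy Py _]] := first_some E'; first by rewrite Dy (negPf nPx) in Py.
by have := first_none E n; rewrite -iterSr -Dy Py.
Qed.

Lemma first_fconnect P x y : first P x = Some y -> fconnect f x y.
Proof. by case/first_some=> n [-> _ _]; apply: fconnect_iter. Qed.

Lemma first_in P x y : first P x = Some y -> P y.
Proof. by case/first_some=> n []. Qed.

Hypothesis f_inj : injective f.

Lemma orbit_rcons x :
  orbit f (f x) = rcons (traject f (f x) (order f x).-1) x.
Proof.
have eq_ord : order f (f x) = order f x.
  by apply: eq_card => y; rewrite -!topredE /= -same_fconnect1.
by rewrite /orbit eq_ord -orderSpred trajectSr -iterSr orderSpred iter_order.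
Qed.

(** In the filtered orbit listed from x the point x is first, and in the one listed from [f x] it is
    last; what follows it in the former is the head of the latter. This turns [next] in the
    definitions of both constructions into a first return. *)
Lemma next_first P x : P x ->
  Some (next [seq y <- orbit f x | P y] x) = first P (f x).
Proof.
move=> Px; rewrite /first orbit_rcons filter_rcons Px /orbit -orderSpred /= Px /=.
by case: (filter _ _) => [|y s]; rewrite /= eqxx.
Qed.

End First.

(** The stretch of orbit between two consecutive points of P is read backwards. This provides the
    inverse of the vertex permutation of m. *)
Lemma first_return (T : finType) (f : T -> T) (P : pred T) x y :
  injective f -> P x -> first f P (f x) = Some y ->
  first (finv f) P (finv f y) = Some x.
Proof.
move=> f_inj Px /first_some [n [Dy Py lt_n]].
have it j : (j <= n)%N -> iter j (finv f) (finv f y) = iter (n - j) f x.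
  elim: j => [|j IHj] lt_j; first by rewrite subn0 /= Dy -iterSr /= finv_f.
  by rewrite iterS IHj 1?ltnW // -[(n - j)%N]prednK ?subn_gt0 // iterS finv_f // subnS.
have := @some_first _ (finv f) P (finv f y) n; rewrite it // subnn; apply=> //.
move=> j lt_j; rewrite it 1?ltnW //; move: (lt_n (n - j).-1).
by rewrite -iterSr prednK ?subn_gt0 // ?ltn_subrL ?(leq_ltn_trans _ lt_j) //; apply; lia.
Qed.

(** * Labeled quadrangulations *)

Definition down (q : cmap) (l : q -> int) (e : q) := l (alpha e) == l e - 1.

(** [lq_face4] and [lq_face2] together give every face period exactly 4 under [phi]. *)
Record lquad (q : cmap) (l : q -> int) : Prop := LQuad {
  lq_sigma : injective (@sigma q);
  lq_alpha : involutive (@alpha q);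
  lq_lab : forall e : q, l (sigma e) = l e;
  lq_adj : forall e : q, l (alpha e) = l e + 1 \/ l (alpha e) = l e - 1;
  lq_face4 : forall e : q, phi (phi (phi (phi e))) = e;
  lq_face2 : forall e : q, phi (phi e) != e }.

(* A face has two half-edges going up; this is the one other than u. *)
Definition mate (q : cmap) (l : q -> int) (u : q) : q :=
  if ~~ down l (phi u) then phi u
  else if ~~ down l (phi (phi u)) then phi (phi u) else phi (phi (phi u)).

(* The next half-edge of the leftmost descending path, if any. *)
Definition descent (q : cmap) (l : q -> int) (d : q) : option q :=
  first (finv (@sigma q)) (down l) (alpha d).

Section LQuad.
Variables (q : cmap) (l : q -> int).
Hypothesis lq : lquad l.
Implicit Types e u d : q.

Let sigma_inj := lq_sigma lq.
Let alphaK := lq_alpha lq.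

Lemma lq_sigma_phi e : sigma (phi e) = alpha e.
Proof. by rewrite /phi f_finv. Qed.

Lemma lq_phi_inj : injective (@phi q).
Proof.
apply: (can_inj (g := fun e => alpha (sigma e))) => e.
by rewrite lq_sigma_phi alphaK.
Qed.

Lemma lq_finv_sigma e : finv (@sigma q) e = phi (alpha e).
Proof. by rewrite /phi alphaK. Qed.

Lemma lq_lab_phi e : l (phi e) = if down l e then l e - 1 else l e + 1.
Proof.
rewrite -(lq_lab lq) lq_sigma_phi /down; case: eqP => // ?.
by case: (lq_adj lq e).
Qed.

Lemma lq_phi_neq e : phi e != e.
Proof. by apply/eqP=> De; have := lq_lab_phi e; rewrite De; case: down; lia. Qed.

Lemma lq_up_alpha e : down l (alpha e) = ~~ down l e.
Proof. by rewrite /down alphaK; case: (lq_adj lq e) => ->; lia. Qed.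

Lemma lq_alpha_neq e : alpha e != e.
Proof.
by apply/eqP=> De; move: (lq_up_alpha e); rewrite De; case: down.
Qed.

Lemma lq_lab_down e : down l e -> l (alpha e) = l e - 1.
Proof. by move/eqP. Qed.

(** The four label changes around a face are 1 or -1 and add up to zero, so exactly two of its sides
    ascend. *)
Lemma up_pattern u : ~~ down l u ->
  (down l (phi u), down l (phi (phi u)), down l (phi (phi (phi u))))
    \in [:: (false, true, true); (true, false, true); (true, true, false)].
Proof.
move=> up; move: (lq_lab_phi u) (lq_lab_phi (phi u)).
move: (lq_lab_phi (phi (phi u))) (lq_lab_phi (phi (phi (phi u)))).
rewrite (lq_face4 lq) (negPf up).
by do 3![case: (down _ (phi _))] => /= *; rewrite ?inE //; lia.
Qed.

Lemma mate_up u : ~~ down l u -> ~~ down l (mate l u).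
Proof.
by move/up_pattern; rewrite !inE /mate => /or3P[] /eqP[d1 d2 d3]; rewrite d1 ?d2 ?d3 ?d1.
Qed.

Lemma mateK u : ~~ down l u -> mate l (mate l u) = u.
Proof.
move=> up; have := up_pattern up; rewrite !inE => /or3P[] /eqP[d1 d2 d3].
- by rewrite [mate l u]/mate d1 /mate d2 d3 (lq_face4 lq).
- by rewrite [mate l u]/mate d1 d2 /mate d3 (lq_face4 lq) up.
by rewrite [mate l u]/mate d1 d2 /mate (lq_face4 lq) up.
Qed.

Lemma mate_phi u : exists n, mate l u = iter n (@phi q) u.
Proof.
by rewrite /mate; case: ifP => _; [exists 1 | case: ifP; [exists 2 | exists 3]].
Qed.

Lemma mate_neq u : mate l u != u.
Proof.
rewrite /mate; case: ifP => _; last case: ifP => _.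
- exact: lq_phi_neq.
- exact: (lq_face2 lq).
apply/eqP=> Du; have := lq_phi_neq u.
by rewrite -{1}Du (lq_face4 lq) eqxx.
Qed.

Lemma lq_descent_rec e : first (finv (@sigma q)) (down l) e =
  if down l e then Some e else first (finv (@sigma q)) (down l) (phi (alpha e)).
Proof. by rewrite first_rec -?lq_finv_sigma. Qed.

Lemma lab_orbit e e' : fconnect (@sigma q) e e' -> l e' = l e.
Proof.
by move/iter_findex <-; elim: (findex _ _ _) => //= n IHn; rewrite (lq_lab lq).
Qed.

Lemma descent_phi d : down l d ->
  descent l d = first (finv (@sigma q)) (down l) (phi d).
Proof.
by move=> dd; rewrite /descent lq_descent_rec lq_up_alpha dd /= alphaK.
Qed.

End LQuad.

(** * From a quadrangulation to a map *)

(** Discrete intermediate values: f drops by at most 1 at each step, so it cannot jump over v. *)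
Lemma first_hit (f : nat -> int) (v : int) n :
  (forall j, f j - 1 <= f j.+1) -> v <= f 0%N -> f n <= v ->
  exists i, [/\ (i <= n)%N, f i = v & forall j, (j < i)%N -> v < f j].
Proof.
move=> f_step le_v fn; have ex : exists i, f i <= v by exists n.
case: (ex_minnP ex) => i fi min_i; exists i.
have gt_v j : (j < i)%N -> v < f j.
  by move=> lt_ji; rewrite ltNge; apply: contraL lt_ji => /min_i; rewrite -leqNgt.
split=> //; first exact: min_i.
case: i fi min_i gt_v => [|i] fi _ gt_v; first by lia.
by have := gt_v i (ltnSn i); have := f_step i; lia.
Qed.

(** For the face permutation this is the successor of x, [None] standing for the added vertex. The
    search may start at x, whose own label is not the one sought. *)
Definition lower (T : finType) (f : T -> T) (lb : T -> int) x :=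
  first f (fun z => lb z == lb x - 1) x.

Variant lower_spec (T : finType) (f : T -> T) (lb : T -> int) x : option T -> Prop :=
| LowerNone of (forall n, lb x <= lb (iter n f x)) : lower_spec f lb x None
| LowerSome n of lb (iter n f x) = lb x - 1
    & (forall j, (j < n)%N -> lb x <= lb (iter j f x)) :
    lower_spec f lb x (Some (iter n f x)).

Lemma lowerP (T : finType) (f : T -> T) (lb : T -> int) x :
  (forall y, lb y - 1 <= lb (f y)) -> lower_spec f lb x (lower f lb x).
Proof.
move=> step; rewrite /lower.
have hit n : lb (iter n f x) < lb x ->
    exists2 i, (i <= n)%N & lb (iter i f x) = lb x - 1.
  move=> lt_n; have [|||i [le_in lab_i _]] :=
    @first_hit (fun i => lb (iter i f x)) (lb x - 1) n => //=; [lia | lia |].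
  by exists i.
case E: (first _ _ _) => [z|].
  have [n [-> /eqP Dn before]] := first_some E.
  constructor=> // j; rewrite leNgt => lt_jn; apply/negP=> /hit[i le_ij lab_i].
  by have := before i (leq_ltn_trans le_ij lt_jn); rewrite lab_i eqxx.
constructor=> n; rewrite leNgt; apply/negP=> /hit[i _ lab_i].
by have := first_none E i; rewrite lab_i eqxx.
Qed.

(* [m] is the map whose half-edges [e] correspond to the descending half-edges
   [t e] of [q] (drawn from the same vertex), as in both constructions; its
   labels are those of [q] up to the constant [c]. *)
Record core_link (q m : cmap) (l : q -> int) (lb : m -> int) (t : m -> q)
    (c : int) : Prop := CoreLink {
  cl_quad : lquad l;
  cl_inj : injective t;
  cl_down : forall e, down l (t e);
  cl_onto : forall d, down l d -> exists e, t e = d;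
  cl_lab : forall e, l (t e) = lb e + c;
  cl_sigma : forall e,
    first (@sigma q) (down l) (sigma (t e)) = Some (t (sigma e));
  cl_alpha : forall e, t (alpha e) = alpha (mate l (alpha (t e))) }.

Definition face_minimal (m : cmap) (lb : m -> int) (e : m) :=
  forall n, lb e <= lb (iter n (@phi m) e).

(** * The face permutation of the map, seen in the quadrangulation *)

Section CoreLink.
Variables (q m : cmap) (l : q -> int) (lb : m -> int) (t : m -> q) (c : int).
Hypothesis cl : core_link l lb t c.
Implicit Types e z : m.

Let lq := cl_quad cl.
Let t_inj := cl_inj cl.
Let sigma_inj := lq_sigma lq.
Let alphaK := lq_alpha lq.

Lemma cl_up e : ~~ down l (alpha (t e)).
Proof. by rewrite (lq_up_alpha lq) negbK (cl_down cl). Qed.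

Lemma cl_sigma_connect e : fconnect (@sigma q) (t e) (t (sigma e)).
Proof.
apply: connect_trans (fconnect1 _ _) _.
exact: first_fconnect (cl_sigma cl e).
Qed.

Lemma cl_lab_sigma e : lb (sigma e) = lb e.
Proof.
by have := lab_orbit lq (cl_sigma_connect e); rewrite !(cl_lab cl); lia.
Qed.

Lemma cl_sigma_inv e :
  first (finv (@sigma q)) (down l) (finv (@sigma q) (t (sigma e))) = Some (t e).
Proof. by apply: first_return (cl_sigma cl e) => //; apply: (cl_down cl). Qed.

Lemma cl_sigma_inj : injective (@sigma m).
Proof.
move=> e e' De; apply: t_inj; apply: Some_inj.
by rewrite -!cl_sigma_inv De.
Qed.

Lemma cl_alphaK : involutive (@alpha m).
Proof.
move=> e; apply: t_inj; rewrite !(cl_alpha cl) alphaK.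
by rewrite (mateK lq) ?cl_up // alphaK.
Qed.

Lemma cl_alpha_neq e : alpha e != e.
Proof.
apply/eqP=> /(congr1 t)/(congr1 (@alpha q)); rewrite (cl_alpha cl) alphaK.
by move/eqP; rewrite (negPf (mate_neq lq _)).
Qed.

Lemma cl_sigma_phi e : sigma (phi e) = alpha e.
Proof. by rewrite /phi (f_finv cl_sigma_inj). Qed.

Lemma cl_phi_inj : injective (@phi m).
Proof.
apply: (can_inj (g := fun e => alpha (sigma e))) => e.
by rewrite cl_sigma_phi cl_alphaK.
Qed.

Lemma cl_lab_alpha e : lb (alpha e) = lb (phi e).
Proof. by rewrite -cl_sigma_phi cl_lab_sigma. Qed.

(** Seen in q, a step along a face of m goes from [alpha (t e)] to the other ascending side of its
    face, then turns clockwise about the end of that side to the first descending half-edge. *)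
Lemma cl_phi e : first (finv (@sigma q)) (down l) (phi (mate l (alpha (t e))))
  = Some (t (phi e)).
Proof.
rewrite -cl_sigma_inv cl_sigma_phi (cl_alpha cl) (lq_finv_sigma lq) alphaK //.
Qed.

(** The cases are the positions of u in its face: first ascent of a simple face, ascent of a
    confluent face, second ascent of a simple face. In the first case the path from [t (phi e)] goes
    on with the last side of the face, which arrives where [t e] arrives and therefore continues in
    the same way. *)
Variant phi_spec e (u := alpha (t e)) : Prop :=
| PhiFirst of ~~ down l (phi u) & mate l u = phi u & t (phi e) = phi (phi u)
    & descent l (t (phi e)) = Some (phi (phi (phi u)))
    & descent l (phi (phi (phi u))) = descent l (t e) & lb (phi e) = lb e + 1
| PhiConfluent of mate l u = phi (phi u) & t (phi e) = phi (phi (phi u))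
    & descent l (t (phi e)) = descent l (t e) & lb (phi e) = lb e
| PhiSecond of mate l u = phi (phi (phi u))
    & descent l (t e) = Some (t (phi e)) & lb (phi e) = lb e - 1.

Lemma phiP e : phi_spec e.
Proof.
have up := cl_up e; have Dphi := cl_phi e; have lphi := cl_lab cl (phi e).
have le := cl_lab cl e; have lu := lq_lab_down (cl_down cl e).
move: (lq_lab_phi lq (alpha (t e))) (lq_lab_phi lq (phi (alpha (t e)))).
move: (lq_lab_phi lq (phi (phi (alpha (t e))))).
rewrite (negPf up); move: Dphi lphi; set u := alpha (t e) in up lu *.
have F4 := lq_face4 lq u.
have := up_pattern lq up; rewrite !inE => /or3P[] /eqP[d1 d2 d3];
  rewrite d1 d2; set l1 := l (phi u); set l2 := l (phi (phi u));
  move=> Dphi lphi /= l3 l1E l2E.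
- have mu : mate l u = phi u by rewrite /mate d1.
  move: Dphi; rewrite mu (lq_descent_rec lq) d2 => -[Dphi].
  constructor; rewrite // -?Dphi.
  + by rewrite d1.
  + by rewrite (descent_phi lq) // (lq_descent_rec lq) d3.
  + by rewrite (descent_phi lq) // F4.
  by move: lphi; rewrite -Dphi -/l2; lia.
- have mu : mate l u = phi (phi u) by rewrite /mate d1 d2.
  move: Dphi; rewrite mu (lq_descent_rec lq) d3 => -[Dphi].
  constructor 2; rewrite // -?Dphi.
    by rewrite (descent_phi lq) // F4.
  by move: lphi; rewrite -Dphi; lia.
have mu : mate l u = phi (phi (phi u)) by rewrite /mate d1 d2.
move: Dphi; rewrite mu F4 => Dphi.
constructor 3 => //.
have := lab_orbit lq (e := u) (e' := t (phi e)); rewrite -same_fconnect_finv //.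
by move/(_ (first_fconnect Dphi)); lia.
Qed.

Lemma cl_lab_phi e : [\/ lb (phi e) = lb e + 1, lb (phi e) = lb e | lb (phi e) = lb e - 1].
Proof. by case: (phiP e) => *; [constructor 1 | constructor 2 | constructor 3]. Qed.

Lemma cl_phi_hit v n e : v <= lb e -> lb (iter n (@phi m) e) <= v ->
  exists i, [/\ (i <= n)%N, lb (iter i (@phi m) e) = v
    & forall j, (j < i)%N -> v < lb (iter j (@phi m) e)].
Proof.
apply: (first_hit (f := fun i => lb (iter i (@phi m) e))) => j /=.
by case: (cl_lab_phi (iter j (@phi m) e)) => ->; lia.
Qed.

(* The successor of e in its face is the next half-edge of the leftmost path:
   after an ascent of the label, use the statement for two shorter stretches. *)
Lemma descent_hit n e : lb (iter n (@phi m) e) = lb e - 1 ->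
  (forall j, (j < n)%N -> lb e <= lb (iter j (@phi m) e)) ->
  descent l (t e) = Some (t (iter n (@phi m) e)).
Proof.
elim/ltn_ind: n e => [[|n] IHn e]; first by rewrite /=; lia.
rewrite iterSr => hit before.
have after j : (j < n)%N -> lb e <= lb (iter j (@phi m) (phi e)).
  by move=> lt_jn; rewrite -iterSr before.
case: (phiP e) => [_ _ _ D1 D2 lab1|_ _ D1 lab1|_ D1 lab1]; last first.
- case: n hit after {before IHn} => [|n] //= _ /(_ 0%N isT) /=; lia.
- rewrite -D1; apply: IHn => //; first by rewrite lab1.
  by rewrite lab1.
(* After an ascent, cut at the first return to the label of e. The first stretch ends on the last
   side of the face of q, from which the leftmost path continues as from [t e]; the second stretch
   gives this continuation. *)
have [||i [le_in lab_i before_i]] := @cl_phi_hit (lb e) n (phi e); try lia.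
have ne_in : i != n by apply/eqP=> Di; move: lab_i hit; rewrite Di; lia.
have lt_in : (i < n)%N by rewrite ltn_neqAle ne_in.
have Di : t (iter i (@phi m) (phi e)) = phi (phi (phi (alpha (t e)))).
  apply: Some_inj; rewrite -D1 (IHn i (ltnW _) (phi e)) ?lab_i ?lab1 //; first by lia.
  by move=> j /before_i; lia.
rewrite -D2 -Di; have Dn : n = ((n - i) + i)%N by rewrite subnK.
rewrite Dn iterD; rewrite Dn iterD -lab_i in hit; apply: IHn => //; first by lia.
by move=> j lt_j; rewrite lab_i -iterD after //; lia.
Qed.

End CoreLink.

Lemma connect_sub_rel (T : finType) (e : rel T) (R : T -> T -> Prop) :
  (forall x, R x x) -> (forall x y z, R x y -> R y z -> R x z) ->
  (forall x y, e x y -> R x y) -> forall x y, connect e x y -> R x y.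
Proof.
move=> Rxx Rtr eR x y /connectP[p]; elim: p x => [|z p IHp] x /=; first by move=> _ ->.
by case/andP=> /eR Rxz /IHp Rz /Rz; apply: Rtr Rxz.
Qed.

Lemma connect_sym_step (T : finType) (e : rel T) :
  (forall x y, e x y -> connect e y x) -> connect_sym e.
Proof.
move=> e_sym; suff imp x y : connect e x y -> connect e y x.
  by move=> x y; apply/idP/idP; apply: imp.
apply: (connect_sub_rel (R := fun x y => connect e y x)) => // z1 z2 z3 c12 c23.
exact: connect_trans c23 c12.
Qed.

(** * Corners of minimal label, and faces of the map as regions of the quadrangulation *)

Section CoreLinkFaces.
Variables (q m : cmap) (l : q -> int) (lb : m -> int) (t : m -> q) (c : int).
Hypothesis cl : core_link l lb t c.
Implicit Types (e z : m) (x y : q).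

Let lq := cl_quad cl.
Let t_inj := cl_inj cl.
Let sigma_inj := lq_sigma lq.
Let alphaK := lq_alpha lq.
Let phi_inj := cl_phi_inj cl.

Lemma iter_phi_loop e : exists n, iter n.+1 (@phi m) e = e.
Proof. by exists (order (@phi m) e).-1; rewrite orderSpred iter_order. Qed.

Lemma face_minimal_iter n e : face_minimal lb e ->
  lb (iter n (@phi m) e) = lb e -> face_minimal lb (iter n (@phi m) e).
Proof. by move=> min_e De i; rewrite De -iterD. Qed.

(** Turning once by [sigma] from [alpha (t e)] leads to the reversal of the last side of its face.
    That side is the image of the next half-edge of m with the label of e: directly if the face is
    confluent, by [descent_hit] after an ascent. A step down would contradict minimality. *)
Lemma face_minimal_next e : face_minimal lb e ->
  exists n, [/\ sigma (alpha (t e)) = alpha (t (iter n.+1 (@phi m) e)),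
    lb (iter n.+1 (@phi m) e) = lb e
  & forall j, (j < n)%N -> lb e < lb (iter j.+1 (@phi m) e)].
Proof.
move=> min_e; have F4 := lq_face4 lq (alpha (t e)).
case: (phiP cl e) => [_ _ _ D1 D2 lab1|_ D1 _ lab1|_ _ lab1]; last first.
- by have /= := min_e 1; rewrite lab1; lia.
- by exists 0%N; rewrite /= D1 -[RHS](lq_sigma_phi lq) F4.
have [n Dn] := iter_phi_loop e.
have [||i [_ lab_i before_i]] := cl_phi_hit cl (v := lb e) (n := n) (e := phi e).
- by rewrite lab1; lia.
- by rewrite -iterSr Dn.
exists i; split=> [||j lt_ji]; rewrite !iterSr //; last exact: before_i.
have := D1; rewrite (descent_hit cl (n := i)).
- by case=> ->; rewrite -[RHS](lq_sigma_phi lq) F4.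
- by rewrite lab_i lab1; lia.
by move=> j /before_i; rewrite lab1; lia.
Qed.

Lemma face_minimal_orbit e x : face_minimal lb e ->
  fconnect (@sigma q) (alpha (t e)) x ->
  exists n, x = alpha (t (iter n (@phi m) e)) /\ lb (iter n (@phi m) e) = lb e.
Proof.
move=> min_e /iter_findex <-; elim: (findex _ _ _) => [|i [n [Dn lab_n]]].
  by exists 0%N.
have [n' [Dn' lab_n' _]] := face_minimal_next (face_minimal_iter min_e lab_n).
by exists (n'.+1 + n)%N; rewrite iterS Dn Dn' iterD lab_n'.
Qed.

Lemma face_minimal_vertex n e : face_minimal lb e ->
  lb (iter n (@phi m) e) = lb e ->
  fconnect (@sigma q) (alpha (t e)) (alpha (t (iter n (@phi m) e))).
Proof.
elim/ltn_ind: n e => [[|n] IHn e min_e Dn] //.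
have [i [Di lab_i before_i]] := face_minimal_next min_e.
apply: connect_trans (fconnect1 _ _) _; rewrite Di.
have le_in : (i <= n)%N.
  by rewrite leqNgt; apply/negP=> /before_i; rewrite Dn ltxx.
have DSn : n.+1 = ((n - i) + i.+1)%N by lia.
rewrite DSn iterD; apply: IHn; first by lia.
  exact: face_minimal_iter.
by rewrite -iterD -DSn Dn lab_i.
Qed.

Lemma face_minimal_up e x : face_minimal lb e ->
  fconnect (@sigma q) (alpha (t e)) x -> ~~ down l x.
Proof. by move=> min_e /(face_minimal_orbit min_e)[n [-> _]]; apply: cl_up cl _. Qed.

Lemma descent_noneP d : descent l d = None <->
  forall x, fconnect (@sigma q) (alpha d) x -> ~~ down l x.
Proof.
split=> [none x | up].
  rewrite -same_fconnect_finv // => /iter_findex <-; exact: first_none none _.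
rewrite /descent; case E: (first _ _ _) => [y|] //.
have: ~~ down l y by apply: up; rewrite -same_fconnect_finv ?(first_fconnect E).
by rewrite (first_in E).
Qed.

Variant descent_spec e : option m -> option q -> Prop :=
| DescentNone of face_minimal lb e : descent_spec e None None
| DescentSome n of lb (iter n (@phi m) e) = lb e - 1
    & (forall j, (j < n)%N -> lb e <= lb (iter j (@phi m) e)) :
    descent_spec e (Some (iter n (@phi m) e)) (Some (t (iter n (@phi m) e))).

Lemma descentP e : descent_spec e (lower (@phi m) lb e) (descent l (t e)).
Proof.
have step z : lb z - 1 <= lb (phi z) by case: (cl_lab_phi cl z) => ->; lia.
case: (lowerP e step) => [min_e|n Dn ge_e].
  have -> : descent l (t e) = None; last by constructor.
  by apply/descent_noneP=> x; apply: face_minimal_up.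
by rewrite (descent_hit cl Dn ge_e); constructor.
Qed.

Lemma face_minimalP e : face_minimal lb e <-> descent l (t e) = None.
Proof.
case: (descentP e) => [|n Dn before] //; split=> // /(_ n); lia.
Qed.

Lemma descent_face e x : descent l (t e) = Some x ->
  exists2 z, fconnect (@phi m) e z & x = t z.
Proof.
case: descentP => // n _ _ [<-]; exists (iter n (@phi m) e) => //.
exact: fconnect_iter.
Qed.

Lemma cl_fconnect e z :
  fconnect (@sigma q) (t e) (t z) = fconnect (@sigma m) e z.
Proof.
apply/idP/idP; last first.
  apply: (connect_sub_rel (R := fun a b => fconnect (@sigma q) (t a) (t b))).
  - by move=> a; apply: connect0.
  - by move=> a1 a2 a3 c12; apply: connect_trans.
  by move=> a b /eqP <-; apply: cl_sigma_connect cl _.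
move/iter_findex; move: (findex _ _ _) => i; elim/ltn_ind: i e => [[|n] IHn] e Dz.
  by rewrite (t_inj Dz) connect0.
apply: connect_trans (fconnect1 _ _) _.
(* Jump to the next descending half-edge; it cannot lie beyond [t z], which descends. *)
have [i [Di _ before]] := first_some (cl_sigma cl e).
have le_in : (i <= n)%N.
  rewrite leqNgt; apply/negP=> /before; rewrite -iterSr Dz; apply/negP.
  by rewrite negbK (cl_down cl).
apply: (IHn (n - i)%N); first by lia.
by rewrite Di -iterD subnK // -iterSr.
Qed.

Definition downward x := if down l x then x else alpha x.

Lemma downward_down x : down l (downward x).
Proof. by rewrite /downward; case: ifPn => //; rewrite (lq_up_alpha lq). Qed.

Lemma downward_alpha x : downward (alpha x) = downward x.
Proof. by rewrite /downward (lq_up_alpha lq) alphaK; case: down. Qed.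

Lemma downward_t e : downward (t e) = t e.
Proof. by rewrite /downward (cl_down cl). Qed.

(** A path in q is lifted to m by replacing each half-edge with the half-edge of m attached to the
    descending half of its edge. This serves for faces and for connectedness. *)
Lemma cl_rel_downward (r : rel m) : reflexive r -> transitive r ->
  forall (e : rel q),
  (forall x y a b, e x y -> t a = downward x -> t b = downward y -> r a b) ->
  forall x y a b, connect e x y -> t a = downward x -> t b = downward y -> r a b.
Proof.
move=> rxx rtr e er x y a b cxy; move: x y cxy a b.
apply: connect_sub_rel => [x a b Da Db|x y z IHxy IHyz a b Da Db|x y exy a b Da Db].
- by rewrite (t_inj (etrans Da (esym Db))).
- have [d Dd] := cl_onto cl (downward_down y).
  by apply: rtr (IHxy a d Da Dd) (IHyz d b Dd Db).
exact: er exy Da Db.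
Qed.

(* Sides of half-edges of [q] that no edge of [m] separates, as in
   [same_region]. *)
Definition face_step x y :=
  [|| y == alpha x, down l x && (y == phi x) | down l y && (x == phi y)].

Lemma connect_face_step x y a b : connect face_step x y ->
  t a = downward x -> t b = downward y -> fconnect (@phi m) a b.
Proof.
have sym := fconnect_sym phi_inj.
apply: (cl_rel_downward (r := fconnect (@phi m))).
- by move=> z; apply: connect0.
- by move=> z1 z2 z3; apply: connect_trans.
have phi_case (z : q) a' b' : down l z -> t a' = z -> t b' = downward (phi z) ->
    fconnect (@phi m) a' b'.
  move=> dz Da; rewrite /downward; case: ifPn => [dphi|up] Db.
    have [|w cw Dw] := @descent_face a' (phi z).
      by rewrite Da (descent_phi lq) // (lq_descent_rec lq) dphi.
    by rewrite (t_inj (etrans Db Dw)).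
  (* The reversal of [phi z] arrives at the end of z and has the same next half-edge as z. If it
     exists, that half-edge lies in both faces of m; otherwise the end of z is a local minimum, and
     the half-edges pointing at it come from one face. *)
  have Dd : descent l (t b') = descent l (t a').
    by rewrite Da Db (descent_phi lq dz) /descent alphaK.
  case E: (descent l (t a')) => [w|].
    have [v cv Dv] := descent_face E; rewrite E in Dd.
    have [v' cv' Dv'] := descent_face Dd.
    by rewrite -(t_inj (etrans (esym Dv) Dv')) sym in cv'; apply: connect_trans cv'.
  have [|n [Dn _]] := @face_minimal_orbit a' (phi z) (proj2 (face_minimalP a') E).
    rewrite Da -same_fconnect_finv // -{2}[z]alphaK -(lq_finv_sigma lq).
    exact: fconnect1.
  rewrite (t_inj (_ : t b' = t (iter n (@phi m) a'))) ?fconnect_iter //.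
  by rewrite Db Dn alphaK.
move=> {}x {}y {}a {}b /or3P[/eqP->|/andP[dx /eqP->]|/andP[dy /eqP->]] Da Db.
- by rewrite downward_alpha -Da in Db; rewrite (t_inj Db) connect0.
- by apply: (phi_case _ _ _ dx _ Db); rewrite Da /downward dx.
by rewrite sym; apply: (phi_case _ _ _ dy _ Da); rewrite Db /downward dy.
Qed.

Lemma face_step_sym : connect_sym face_step.
Proof.
apply: connect_sym_step => x y /or3P[/eqP->|dx|dy]; apply: connect1.
- by rewrite /face_step alphaK eqxx.
- by rewrite /face_step dx !orbT.
by rewrite /face_step dy !orbT.
Qed.

Lemma face_step_alpha x : connect face_step x (alpha x).
Proof. by apply: connect1; rewrite /face_step eqxx. Qed.

Lemma face_step_phi x : down l x -> connect face_step x (phi x).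
Proof. by move=> dx; apply: connect1; rewrite /face_step dx eqxx /= orbT. Qed.

Lemma face_step_first x y :
  first (finv (@sigma q)) (down l) x = Some y -> connect face_step x y.
Proof.
case/first_some=> n [-> _]; elim: n => // n IHn before.
apply: connect_trans (IHn _) _ => [j lt_j|]; first exact: before (ltnW lt_j).
rewrite iterS (lq_finv_sigma lq); apply: connect_trans (face_step_alpha _) _.
by apply: face_step_phi; rewrite (lq_up_alpha lq) before.
Qed.

(** A step of [phi] in m appears in q either as a passage along descending sides of one face or as a
    clockwise turn past ascending half-edges, and [face_step] allows both. *)
Lemma fconnect_face_step a b :
  fconnect (@phi m) a b -> connect face_step (t a) (t b).
Proof.
apply: (connect_sub_rel (R := fun a b => connect face_step (t a) (t b))).
- by move=> z; apply: connect0.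
- by move=> z1 z2 z3; apply: connect_trans.
move=> {}a {}b /eqP <-; have ca := face_step_alpha (t a).
have F4 := lq_face4 lq (alpha (t a)).
have up := up_pattern lq (cl_up cl a).
case: (phiP cl a) => [up1 _ D1 _ _ _|_ D1 _ _|_ D1 _].
- move: up; rewrite (negPf up1) !inE => /or3P[] // /eqP[d2 d3].
  apply: connect_trans ca _; rewrite D1 face_step_sym.
  apply: connect_trans (face_step_phi d2) _.
  by rewrite -{2}F4; apply: face_step_phi.
- apply: connect_trans ca _; rewrite face_step_sym -F4 -D1.
  exact/face_step_phi/(cl_down cl).
apply: connect_trans ca _; exact: face_step_first D1.
Qed.

Definition glue (p : cmap) : rel p := relU (frel (@sigma p)) (frel (@alpha p)).

End CoreLinkFaces.

(** * Counting and connectedness *)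

(** Equal fibres give a bijection between the images, whatever the codomains; intended for [org e]
    in m against [org (t e)] in q. *)
Lemma card_eq_imset (T A B : finType) (f : T -> A) (g : T -> B) :
  (forall x y, (f x == f y) = (g x == g y)) ->
  #|[set f x | x : T]| = #|[set g x | x : T]|.
Proof.
move=> eq_fg; pose h (y : A) := omap g [pick x | f x == y].
have hf x : h (f x) = Some (g x).
  rewrite /h; case: pickP => [z|/(_ x)]; last by rewrite eqxx.
  by rewrite eq_fg => /eqP /= ->.
have inj_h : {in [set f x | x : T] &, injective h}.
  move=> _ _ /imsetP[x _ ->] /imsetP[y _ ->]; rewrite !hf => -[/eqP].
  by rewrite -eq_fg => /eqP.
rewrite -(card_in_imset inj_h) -[RHS](card_imset _ (@Some_inj _)).
rewrite -!imset_comp; congr #|pred_of_set _|; apply: eq_imset => x /=; exact: hf.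
Qed.

Lemma card_classes (T : finType) (F : T -> {set T}) n :
  (forall x y, (F x == F y) = (y \in F x)) -> (forall x, #|F x| = n) ->
  (#|[set F x | x : T]| * n)%N = #|T|.
Proof.
move=> FP Fn; rewrite -[RHS]sum1_card (partition_big_imset F) /=.
rewrite -sum_nat_const; apply: eq_big => [A|_ /imsetP[x _ ->]].
  by apply/imsetP/imsetP=> -[x _ ->]; exists x.
by rewrite -(Fn x) -sum1_card; apply: eq_bigl => y; rewrite eq_sym FP.
Qed.

Section MapCounts.
Variable m : cmap.

Lemma org_eq (e e' : m) : injective (@sigma m) ->
  (org e == org e') = (e' \in org e).
Proof.
move=> s_inj; have sym := fconnect_sym s_inj.
apply/eqP/idP => [->|]; first by rewrite inE connect0.
by rewrite inE => c; apply/setP=> x; rewrite !inE (same_connect sym c).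
Qed.

Lemma face_eq (e e' : m) : injective (@phi m) ->
  (face_of e == face_of e') = (e' \in face_of e).
Proof.
move=> s_inj; have sym := fconnect_sym s_inj.
apply/eqP/idP => [->|]; first by rewrite inE connect0.
by rewrite inE => c; apply/setP=> x; rewrite !inE (same_connect sym c).
Qed.

Lemma card_edges : involutive (@alpha m) -> (forall e : m, alpha e != e) ->
  (#|edges m| * 2)%N = #|m|.
Proof.
move=> aK a_neq; apply: card_classes => [x y|x]; last by rewrite cards2 eq_sym a_neq.
apply/eqP/idP => [->|]; first by rewrite !inE eqxx.
by rewrite !inE => /orP[]/eqP-> //; rewrite aK setUC.
Qed.

Lemma glue_sym : injective (@sigma m) -> injective (@alpha m) ->
  connect_sym (glue (p := m)).
Proof.
move=> s_inj a_inj; apply: connect_sym_step => x _ /orP[]/eqP<-.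
  apply: (connect_sub (e := frel (@sigma m))) => [y z yz|].
    by apply: connect1; apply/orP; left.
  by rewrite (fconnect_sym s_inj) fconnect1.
apply: (connect_sub (e := frel (@alpha m))) => [y z yz|].
  by apply: connect1; apply/orP; right.
by rewrite (fconnect_sym a_inj) fconnect1.
Qed.

Lemma fconnect_sigma_glue (x y : m) :
  fconnect (@sigma m) x y -> connect (glue (p := m)) x y.
Proof.
apply: connect_sub => {}x {}y xy; apply: connect1; by apply/orP; left.
Qed.

Lemma alpha_glue (x : m) : connect (glue (p := m)) x (alpha x).
Proof. by apply: connect1; rewrite /glue /= eqxx orbT. Qed.

Lemma phi_glue (x y : m) : injective (@sigma m) -> injective (@alpha m) ->
  fconnect (@phi m) x y -> connect (glue (p := m)) x y.
Proof.
move=> s_inj a_inj; apply: (connect_sub_rel (R := fun x y => connect (glue (p := m)) x y)) => [z|z1 z2 z3|z _ /eqP <-].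
- exact: connect0.
- exact: connect_trans.
apply: connect_trans (alpha_glue z) _; rewrite glue_sym //.
by rewrite -[X in connect _ _ X](f_finv s_inj); apply: connect1; rewrite /glue /= eqxx.
Qed.

End MapCounts.

Section CoreLinkCounts.
Variables (q m : cmap) (l : q -> int) (lb : m -> int) (t : m -> q) (c : int).
Hypothesis cl : core_link l lb t c.
Implicit Types (e z : m) (x y : q).

Let lq := cl_quad cl.
Let t_inj := cl_inj cl.
Let sigma_inj := lq_sigma lq.
Let alphaK := lq_alpha lq.
Let alpha_inj := inv_inj alphaK.
Let msigma_inj := cl_sigma_inj cl.
Let malpha_inj := inv_inj (cl_alphaK cl).

Lemma card_link : #|q| = (2 * #|m|)%N.
Proof.
rewrite mulnC -card_bool -card_prod; symmetry.
pose h (u : m * bool) := if u.2 then t u.1 else alpha (t u.1).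
have h_inj : injective h.
  move=> [e b] [e' b'] Dh; have := congr1 (down l) Dh; move: Dh; rewrite /h /=.
  by case: b; case: b' => Dh; rewrite ?(cl_down cl) ?(negPf (cl_up cl _)) //;
    rewrite ?(t_inj Dh) // (t_inj (alpha_inj Dh)).
rewrite -(card_imset _ h_inj); apply/eqP; rewrite eqn_leq max_card /=.
rewrite cardE -cardE; apply/subset_leq_card/subsetP=> x _; apply/imsetP.
have [e De] := cl_onto cl (downward_down cl x).
move: De; rewrite /downward; case: ifP => _ De; first by exists (e, true).
by exists (e, false) => //; rewrite /h /= De alphaK.
Qed.

Lemma card_face_of x : #|face_of x| = 4%N.
Proof.
have F4 := lq_face4 lq x; have F2 := lq_face2 lq.
have pn := lq_phi_neq lq.
pose p := [:: x; phi x; phi (phi x); phi (phi (phi x))].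
have cyc : fcycle (@phi q) p by rewrite /= !eqxx F4 eqxx.
have up : uniq p.
  have p3 : phi (phi (phi x)) != x by rewrite eq_sym -{1}F4 pn.
  rewrite /= !inE !negb_or [x == _]eq_sym pn [x == _]eq_sym F2 [x == _]eq_sym p3.
  by rewrite [phi x == _]eq_sym pn [phi x == _]eq_sym F2 [_ == phi (phi (phi x))]eq_sym pn.
rewrite -[RHS]/(size p) -(order_cycle cyc up (mem_head _ _)).
by apply: eq_card => y; rewrite inE.
Qed.

Lemma card_faces_link : (#|faces q| * 4)%N = #|q|.
Proof.
apply: card_classes => [x y|]; last exact: card_face_of.
by apply: face_eq; apply: lq_phi_inj lq.
Qed.

(** A path of q may pass through a local minimum, which is not a vertex of m. The half-edges
    pointing at it come from one face of m, and [phi] joins them there. *)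
Lemma cl_connected : (forall x y : q, connect (glue (p := q)) x y) ->
  forall e z, connect (glue (p := m)) e z.
Proof.
move=> cq e z; have sym := glue_sym msigma_inj malpha_inj.
apply: (cl_rel_downward cl (r := connect (glue (p := m)))) (cq (t e) (t z)) _ _.
- by move=> a; apply: connect0.
- by move=> a1 a2 a3; apply: connect_trans.
- move=> x y a b /orP[]/eqP<- Da Db; last first.
    by rewrite (downward_alpha cl) -Da in Db; rewrite (t_inj Db) connect0.
  (* Either a descending half-edge leaves the origin of w, which is then a vertex of m joined to d,
     or this origin is a local minimum. *)
  have reach w d : t d = downward l w ->
      (exists2 n, connect (glue (p := m)) d n & fconnect (@sigma q) w (t n))
      \/ face_minimal lb d /\ w = alpha (t d).
    rewrite /downward; case: ifPn => [dw|uw] Dd.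
      by left; exists d; rewrite // Dd.
    have Dw : w = alpha (t d) by rewrite Dd alphaK.
    case E: (descent l (t d)) => [v|].
      have [n cn Dv] := descent_face cl E; left; exists n.
        exact: phi_glue cn.
      by rewrite -same_fconnect_finv // Dw -Dv; apply: first_fconnect E.
    by right; split=> //; apply/(face_minimalP cl).
  have sx := fconnect1 (@sigma q) x.
  case: (reach _ _ Da) (reach _ _ Db) => [[n cn xn]|[min_a Dx]] [[n' cn' xn']|[min_b Dx']].
  - apply: connect_trans cn _; rewrite sym; apply: connect_trans cn' _.
    apply: fconnect_sigma_glue; rewrite -(cl_fconnect cl).
    rewrite (fconnect_sym sigma_inj) in xn'; apply: connect_trans xn' _.
    by rewrite -(same_fconnect1 sigma_inj).
  - have: ~~ down l (t n); last by rewrite (cl_down cl).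
    by apply: (face_minimal_up cl min_b); rewrite -Dx' -(same_fconnect1 sigma_inj).
  - have: ~~ down l (t n'); last by rewrite (cl_down cl).
    by apply: (face_minimal_up cl min_a); rewrite -Dx (same_fconnect1 sigma_inj).
  have [|n [Dn _]] := face_minimal_orbit cl min_a (x := sigma x).
    by rewrite -Dx.
  rewrite (t_inj (_ : t b = t (iter n (@phi m) a))).
    by apply: phi_glue => //; apply: fconnect_iter.
  by apply: alpha_inj; rewrite -Dx' Dn.
- by rewrite (downward_t cl).
by rewrite (downward_t cl).
Qed.

Lemma cl_connected_inv : (forall e z, connect (glue (p := m)) e z) ->
  forall x y : q, connect (glue (p := q)) x y.
Proof.
move=> cm; have sym := glue_sym sigma_inj alpha_inj.
have ct e z : connect (glue (p := q)) (t e) (t z).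
  move: (cm e z); apply: (connect_sub_rel (R := fun a b => connect (glue (p := q)) (t a) (t b))).
  - by move=> a; apply: connect0.
  - by move=> a1 a2 a3; apply: connect_trans.
  move=> a _ /orP[]/eqP<-; first exact/fconnect_sigma_glue/(cl_sigma_connect cl).
  rewrite (cl_alpha cl); apply: connect_trans (alpha_glue _) _.
  apply: connect_trans (alpha_glue _).
  by have [n ->] := mate_phi l (alpha (t a)); apply: phi_glue => //; apply: fconnect_iter.
have cd x : connect (glue (p := q)) x (downward l x).
  by rewrite /downward; case: ifP => _; [apply: connect0 | apply: alpha_glue].
move=> x y; have [e De] := cl_onto cl (downward_down cl x).
have [z Dz] := cl_onto cl (downward_down cl y).
apply: connect_trans (cd x) _; rewrite sym; apply: connect_trans (cd y) _.
by rewrite -De -Dz.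
Qed.

End CoreLinkCounts.

(** * Distances and labels *)

Section Distance.
Variable m : cmap.
Implicit Types (u v w : {set m}) (e : m).

Lemma walkP n u v : reflect
  (exists p, [/\ size p = n, path (@adj m) u p & last u p = v]) (walk n u v).
Proof.
apply: (iffP existsP) => [[p /andP[up /eqP lp]]|[p [sp up lp]]].
  by exists p; rewrite size_tuple.
by rewrite -sp; exists (in_tuple p); rewrite up lp eqxx.
Qed.

Lemma org_vertices e : org e \in vertices m.
Proof. exact: imset_f. Qed.

Lemma adj_edge e : adj (org e) (org (alpha e)).
Proof. by apply/existsP; exists e; rewrite !eqxx. Qed.

Lemma walk0 u : walk 0 u u.
Proof. by apply/walkP; exists [::]. Qed.

Lemma walk_edge e : walk 1 (org e) (org (alpha e)).
Proof. by apply/walkP; exists [:: org (alpha e)]; rewrite /= adj_edge. Qed.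

Lemma walk_cat n n' u v w : walk n u v -> walk n' v w -> walk (n + n') u w.
Proof.
case/walkP=> p [sp up lp] /walkP[p' [sp' vp' lp']]; apply/walkP; exists (p ++ p').
by rewrite size_cat sp sp' cat_path up lp vp' last_cat lp.
Qed.

(** Loops are removed from the walk, so the range of lengths in [dist] always suffices. *)
Lemma walk_short n u v : u \in vertices m -> walk n u v ->
  exists s, [/\ (s <= n)%N, (s < #|vertices m|)%N & walk s u v].
Proof.
move=> uV /walkP[p [<- up lp]]; case/shortenP: up lp => p' up' uniq_p' sub_p' lp'.
exists (size p'); split; last by apply/walkP; exists p'.
  by apply: uniq_leq_size => //; case/andP: uniq_p'.
have -> : (size p').+1 = #|u :: p'| by rewrite (card_uniqP uniq_p').
apply/subset_leq_card/subsetP => x; rewrite inE => /predU1P[-> // |].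
elim: p' u up' {uniq_p' sub_p' lp' uV} => //= w p' IHp u /andP[uw wp'].
rewrite inE => /predU1P[->|]; last exact: IHp wp'.
by case/existsP: uw => e /andP[_ /eqP <-]; apply: org_vertices.
Qed.

Lemma dist_le n u v : u \in vertices m -> walk n u v -> (dist u v <= n)%N.
Proof.
move=> uV /(walk_short uV)[s [le_sn lt_s ws]]; apply: leq_trans le_sn.
rewrite /dist -minEnat.
exact: (bigmin_le_cond _ (j := Ordinal lt_s) (fun i : 'I__ => i : nat)).
Qed.

Lemma dist_walk n u v : u \in vertices m -> walk n u v -> walk (dist u v) u v.
Proof.
move=> uV /(walk_short uV)[s [le_sn lt_s ws]]; rewrite /dist -minEnat.
rewrite (@bigmin_eq_arg _ _ _ _ (Ordinal lt_s) _ (fun i : 'I__ => i : nat)) //.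
  by case: arg_minP.
by move=> i _; rewrite leEnat ltnW.
Qed.

Hypothesis m_map : is_map m.

Lemma map_sigma_inj : injective (@sigma m). Proof. by case: m_map. Qed.

Lemma map_alphaK : involutive (@alpha m). Proof. by case: m_map. Qed.

Lemma org_sigma e : org (sigma e) = org e.
Proof.
by apply/eqP; rewrite eq_sym (org_eq _ _ map_sigma_inj) inE fconnect1.
Qed.

Lemma walk_exists u v : u \in vertices m -> v \in vertices m ->
  exists n, walk n u v.
Proof.
case/imsetP=> e _ -> /imsetP[e' _ ->]; case: m_map => _ _ _ _ /(_ e e').
move: e e'; apply: connect_sub_rel => [e|e1 e2 e3 [n w] [n' w']|e _ /orP[]/eqP<-].
- by exists 0%N; apply: walk0.
- by exists (n + n')%N; apply: walk_cat w w'.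
- by exists 0%N; rewrite org_sigma; apply: walk0.
by exists 1%N; apply: walk_edge.
Qed.

Lemma walk_dist u v : u \in vertices m -> v \in vertices m -> walk (dist u v) u v.
Proof. by move=> uV vV; have [n] := walk_exists uV vV; apply: dist_walk. Qed.

Lemma walk_sym n u v : walk n u v -> walk n v u.
Proof.
case/walkP=> p [<-]; elim: p u {n} => [|w p IHp] u /=.
  by move=> _ ->; apply: walk0.
case/andP=> /existsP[e /andP[/eqP <- /eqP <-]] pathp lastp.
rewrite -addn1; apply: walk_cat (IHp _ pathp lastp) _.
by rewrite -{2}(map_alphaK e); apply: walk_edge.
Qed.

Lemma dist0 u : u \in vertices m -> dist u u = 0%N.
Proof. by move=> uV; apply/eqP; rewrite -leqn0 dist_le ?walk0. Qed.

Lemma dist_edge e v : v \in vertices m ->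
  (dist (org e) v <= (dist (org (alpha e)) v).+1)%N.
Proof.
move=> vV; apply: dist_le (org_vertices _) _; rewrite -add1n.
by apply: walk_cat (walk_edge e) (walk_dist _ _) => //; apply: org_vertices.
Qed.

End Distance.

(** * Labels along walks *)

Section LabelWalk.
Variables (m : cmap) (l : m -> int).
Hypothesis l_org : forall e e', fconnect (@sigma m) e e' -> l e' = l e.
Hypothesis l_adj : forall e, l (alpha e) = l e + 1 \/ l (alpha e) = l e - 1.

Lemma org_in (e : m) : e \in org e.
Proof. by rewrite inE connect0. Qed.

Lemma l_org_eq e e' : org e = org e' -> l e = l e'.
Proof. by move=> De; apply: l_org; have := org_in e; rewrite De inE. Qed.

Lemma walk_lab n e e' : walk n (org e) (org e') ->
  `|l e' - l e| <= n%:Z /\ exists z, n%:Z + l e' - l e = 2 * z.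
Proof.
case/walkP=> p [<-]; elim: p e {n} => [|v p IHp] e /=.
  by move=> _ /l_org_eq ->; split; [lia | exists 0; lia].
case/andP=> /existsP[e1 /andP[/eqP/l_org_eq <- /eqP<-]] pathp lastp.
have [le_l [z Dz]] := IHp _ pathp lastp; case: (l_adj e1) => De1.
  by split; [lia | exists (z + 1); lia].
by split; [lia | exists z; lia].
Qed.

(** The first edge leaves a local minimum upwards, which improves the bound of [walk_lab] by 2. This
    is the source of the strict inequalities on delays. *)
Lemma walk_lab_min n e e' : (0 < n)%N ->
  (forall y, fconnect (@sigma m) e y -> ~~ down l y) ->
  walk n (org e) (org e') -> l e - l e' + 2 <= n%:Z.
Proof.
move=> n_gt0 min_e /walkP[[|v p] [Dn /= + lastp]]; first by rewrite -Dn in n_gt0.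
case/andP=> /existsP[e1 /andP[/eqP Do /eqP Dv]] pathp.
have ue1 : ~~ down l e1 by apply: min_e; have := org_in e1; rewrite Do inE.
have [|le_l _] := @walk_lab (size p) (alpha e1) e'.
  by apply/walkP; exists p; rewrite -Dv in pathp lastp.
move: ue1 le_l; rewrite -Dn /down (l_org_eq (esym Do)).
by case: (l_adj e1) => -> /=; lia.
Qed.

End LabelWalk.

(** * Sources and faces *)

(** [lk_fac] only asks the face of e to contain some half-edge pointing at the i-th source; that
    faces and sources correspond one to one is derived from it. *)
Record linked (k : nat) (q : pointed_map k) (m : labeled_map k) (l : q -> int)
    (t : m -> q) (c : int) : Prop := Linked {
  lk_core : core_link l (@lab k m) t c;
  lk_src : forall i, exists e, src q i = org e;
  lk_src_inj : injective (src q);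
  lk_src_min : forall x, (exists i, x \in src q i) <->
    (forall y, fconnect (@sigma q) x y -> ~~ down l y);
  lk_delay : forall i x, x \in src q i -> l x = delay q i;
  lk_fac : forall i e, e \in fac m i <->
    exists z, fconnect (@phi m) e z /\ alpha (t z) \in src q i }.

Section Linked.
Variables (k : nat) (q : pointed_map k) (m : labeled_map k) (l : q -> int).
Variables (t : m -> q) (c : int).
Hypothesis lk : linked l t c.
Implicit Types (e z : m) (x y : q).

Let cl := lk_core lk.
Let lq := cl_quad cl.
Let t_inj := cl_inj cl.
Let sigma_inj := lq_sigma lq.
Let alphaK := lq_alpha lq.
Let alpha_inj := inv_inj alphaK.
Let mphi_inj := cl_phi_inj cl.

Lemma src_org i x : x \in src q i -> src q i = org x.
Proof. by have [e ->] := lk_src lk i => ex; apply/eqP; rewrite org_eq. Qed.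

Lemma src_up i x : x \in src q i -> ~~ down l x.
Proof. by move=> xi; apply: (proj1 (lk_src_min lk x)); [exists i | apply: connect0]. Qed.

Lemma src_uniq i j x : x \in src q i -> x \in src q j -> i = j.
Proof. by move=> xi xj; apply: (lk_src_inj lk); rewrite (src_org xi) (src_org xj). Qed.

Lemma minimal_src e : face_minimal (@lab k m) e -> exists i, alpha (t e) \in src q i.
Proof.
by move=> min_e; apply/(lk_src_min lk) => y; apply: face_minimal_up cl _ _ min_e.
Qed.

Lemma src_minimal i e : alpha (t e) \in src q i -> face_minimal (@lab k m) e.
Proof.
move=> ei; apply/(face_minimalP cl)/(descent_noneP cl).
by apply/(lk_src_min lk); exists i.
Qed.

Lemma src_fac i e : alpha (t e) \in src q i -> e \in fac m i.
Proof. by move=> ei; apply/(lk_fac lk); exists e; rewrite connect0. Qed.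

Lemma minimal_same_lab e z : face_minimal (@lab k m) e -> face_minimal (@lab k m) z ->
  fconnect (@phi m) e z -> lab z = lab e.
Proof.
move=> min_e min_z ez; have := ez; rewrite (fconnect_sym mphi_inj).
move/iter_findex=> De; move/iter_findex: ez => Dz.
have := min_e (findex (@phi m) e z); have := min_z (findex (@phi m) z e).
by rewrite De Dz => *; apply/eqP; rewrite eq_le; apply/andP.
Qed.

Lemma minimal_same_src i e z : alpha (t e) \in src q i ->
  face_minimal (@lab k m) z -> fconnect (@phi m) e z -> alpha (t z) \in src q i.
Proof.
move=> ei min_z ez; rewrite (src_org ei) inE.
have Dl := minimal_same_lab (src_minimal ei) min_z ez.
rewrite -(iter_findex ez) in Dl *.
exact: face_minimal_vertex cl _ _ (src_minimal ei) Dl.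
Qed.

Lemma fac_src i e : face_minimal (@lab k m) e -> e \in fac m i ->
  alpha (t e) \in src q i.
Proof.
move=> min_e /(lk_fac lk)[z [ez zi]]; apply: minimal_same_src zi min_e _.
by rewrite (fconnect_sym mphi_inj).
Qed.

Lemma face_minimal_exists e :
  exists2 z, fconnect (@phi m) e z & face_minimal (@lab k m) z.
Proof.
pose z := [arg min_(z < e | fconnect (@phi m) e z) lab z]%O; exists z.
  by rewrite /z; case: arg_minP => //; apply: connect0.
rewrite /z; case: arg_minP => [|a ea min_a n]; first exact: connect0.
by apply: min_a; apply: connect_trans ea (fconnect_iter _ _ _).
Qed.

Lemma src_minimal_exists i : exists2 z, face_minimal (@lab k m) z & alpha (t z) \in src q i.
Proof.
have [x Dx] := lk_src lk i; have xi : x \in src q i by rewrite Dx org_in.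
have [|z Dz] := cl_onto cl (d := alpha x).
  by rewrite (lq_up_alpha lq); apply: src_up xi.
have zi : alpha (t z) \in src q i by rewrite Dz alphaK.
by exists z => //; apply: src_minimal zi.
Qed.

Lemma fac_face i e : e \in fac m i -> fac m i = face_of e.
Proof.
case/(lk_fac lk)=> z [ez zi]; apply/setP=> a; rewrite inE.
apply/idP/idP => [/(lk_fac lk)[b [ab bi]]|ea].
  apply: (connect_trans ez); rewrite (fconnect_sym mphi_inj); apply: (connect_trans ab).
  have : fconnect (@sigma q) (alpha (t b)) (alpha (t z)).
    by rewrite (src_org bi) inE in zi.
  case/(face_minimal_orbit cl (src_minimal bi))=> n [/alpha_inj/t_inj -> _].
  exact: fconnect_iter.
apply/(lk_fac lk); exists z; split=> //; rewrite (fconnect_sym mphi_inj) in ea.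
exact: connect_trans ea ez.
Qed.

Lemma fac_inj : injective (fac m).
Proof.
move=> i j Dij; have [z min_z zi] := src_minimal_exists i.
by apply: (src_uniq zi); apply: fac_src => //; rewrite -Dij; apply: src_fac.
Qed.

Lemma face_fac e : exists i, fac m i = face_of e.
Proof.
have [z ez /minimal_src[i zi]] := face_minimal_exists e; exists i.
by apply: fac_face; apply/(lk_fac lk); exists z.
Qed.

Lemma faces_fac : [set fac m i | i : 'I_k] = faces m.
Proof.
apply/setP=> f; apply/imsetP/imsetP => [[i _ ->]|[e _ ->]]; last first.
  by have [i Di] := face_fac e; exists i.
have [z _ /src_fac/fac_face ->] := src_minimal_exists i.
by exists z.
Qed.

Lemma card_faces_linked : #|faces m| = k.
Proof. by rewrite -faces_fac (card_imset _ fac_inj) card_ord. Qed.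

(** A vertex of q that some descending half-edge leaves is a vertex of m, by [cl_fconnect]; any
    other one is a local minimum, hence a source. *)
Lemma card_vertices_linked : (#|vertices q| = #|vertices m| + k)%N.
Proof.
have -> : #|vertices m| = #|[set org (t e) | e : m]|.
  apply: card_eq_imset => e z; rewrite !org_eq //; last exact: cl_sigma_inj cl.
  by rewrite !inE (cl_fconnect cl).
rewrite -[X in (_ + X)%N]card_ord -(card_imset _ (lk_src_inj lk)).
rewrite -cardsUI (_ : _ :&: _ = set0) ?cards0 ?addn0.
  congr #|pred_of_set _|; apply/setP=> v; rewrite inE; apply/imsetP/orP.
    case=> x _ ->; case: (pickP (fun y => fconnect (@sigma q) x y && down l y)) => [y|none].
      case/andP=> xy /(cl_onto cl)[e De]; left; apply/imsetP; exists e => //.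
      by apply/eqP; rewrite org_eq // inE De.
    right; have [|i xi] := proj2 (lk_src_min lk x).
      by move=> y xy; have := none y; rewrite xy /= => ->.
    by apply/imsetP; exists i; rewrite // (src_org xi).
  case=> /imsetP[x _ ->]; first by exists (t x).
  by have [e ->] := lk_src lk x; exists e.
apply/setP=> v; rewrite !inE; apply/negP=> /andP[/imsetP[e _ ->] /imsetP[i _ Di]].
have ei : t e \in src q i by rewrite -Di org_in.
by have := src_up ei; rewrite (cl_down cl).
Qed.

Lemma card_edges_link : (#|edges q| = 2 * #|faces q|)%N /\ #|faces q| = #|edges m|.
Proof.
have Eq := card_edges alphaK (lq_alpha_neq lq).
have Em := card_edges (cl_alphaK cl) (cl_alpha_neq cl).
have := card_faces_link cl; have := card_link cl; move: Eq Em => /=; lia.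
Qed.

Lemma linked_LM g : is_map_of_genus q g -> is_LM g m.
Proof.
case=> -[_ _ _ [x] cq] genus_q; split.
- split; first split.
  + exact: cl_sigma_inj cl.
  + exact: cl_alphaK cl.
  + exact: cl_alpha_neq cl.
  + by have [e _] := cl_onto cl (downward_down cl x); exists.
  + exact: cl_connected cl cq.
  (* Euler's formula: q has k more vertices than m, twice as many edges, and as many faces as m has
     edges, while m has k faces. *)
  move: card_edges_link genus_q; rewrite card_vertices_linked card_faces_linked; lia.
- exact: fac_inj.
- exact: faces_fac.
split=> e; first exact: cl_lab_sigma cl e.
by rewrite (cl_lab_alpha cl); case: (cl_lab_phi cl e) => ->; lia.
Qed.

Lemma linked_map_of_genus g : is_map_of_genus m g -> is_map_of_genus q g.
Proof.
case=> -[_ _ _ [e] cm] genus_m; split; first split=> //.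
- exact: lq_alpha_neq lq.
- by exists; exact: t e.
- exact: cl_connected_inv cl cm.
move: card_edges_link genus_m; rewrite card_vertices_linked card_faces_linked; lia.
Qed.

Lemma linked_Q g : is_map_of_genus q g -> is_Q g q.
Proof.
move=> q_g; have [q_map _] := q_g; have l_orb := lab_orbit lq; have l_adj := lq_adj lq.
have srcV i : src q i \in vertices q by have [x ->] := lk_src lk i; apply: org_vertices.
have min_src i x : src q i = org x -> forall y, fconnect (@sigma q) x y -> ~~ down l y.
  by move=> Di; apply: (proj1 (lk_src_min lk x)); exists i; rewrite Di org_in.
have delay_src i x : src q i = org x -> l x = delay q i.
  by move=> Di; apply: (lk_delay lk); rewrite Di org_in.
split=> //.
- by move=> _ /imsetP[x _ ->]; exact: card_face_of cl x.
(* Labels of adjacent vertices differ by 1, so their parity is a proper colouring. *)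
- exists (fun v : {set q} => [exists x in v, (2 %| l x)%Z]) => x.
  have even_org y : [exists x in org y, (2 %| l x)%Z] = (2 %| l y)%Z.
    apply/existsP/idP => [[z /andP[]]|]; first by rewrite inE => /l_orb ->.
    by exists y; rewrite org_in.
  by rewrite !even_org; case: (l_adj x) => ->; lia.
split=> // i j.
  have [x Dx] := lk_src lk i; have [y Dy] := lk_src lk j.
  move=> ne_ij; have wij := walk_dist q_map (srcV i) (srcV j).
  have d_gt0 : (0 < dist (src q i) (src q j))%N.
    rewrite lt0n; apply/eqP=> d0; move: wij.
    rewrite d0 => /walkP[p [/size0nil -> _ /= /(lk_src_inj lk) Dij]].
    by rewrite Dij eqxx in ne_ij.
  have wji := walk_sym q_map wij; rewrite Dx Dy in wij wji d_gt0 *.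
  have := walk_lab_min l_orb l_adj d_gt0 (min_src _ _ Dx) wij.
  have := walk_lab_min l_orb l_adj d_gt0 (min_src _ _ Dy) wji.
  by rewrite -(delay_src _ _ Dx) -(delay_src _ _ Dy); lia.
have := walk_dist q_map (srcV j) (srcV i); have wij := walk_dist q_map (srcV i) (srcV j).
have [x Dx] := lk_src lk i; have [y Dy] := lk_src lk j; rewrite /= => wji.
have wij' := walk_sym q_map wij; rewrite Dx Dy in wij' *.
have [le_l [z Dz]] := walk_lab l_orb l_adj wij'.
rewrite -(delay_src _ _ Dx) -(delay_src _ _ Dy) Dz.
by split; [apply/dvdzP; exists z; rewrite mulrC | rewrite -Dz; lia].
Qed.

End Linked.

(** * Isomorphisms *)

Section Transport.
Variables (T T' : finType) (f : T -> T) (f' : T' -> T') (h : T -> T').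
Hypotheses (h_inj : injective h) (hf : forall x, h (f x) = f' (h x)).

Lemma iter_transport n x : h (iter n f x) = iter n f' (h x).
Proof. by elim: n => //= n <-. Qed.

Lemma fconnect_transport x y : fconnect f' (h x) (h y) = fconnect f x y.
Proof.
apply/idP/idP => /iter_findex; last by move <-; rewrite iter_transport fconnect_iter.
by rewrite -iter_transport => /h_inj <-; apply: fconnect_iter.
Qed.

Lemma first_transport (P : pred T) (P' : pred T') x :
  (forall y, P' (h y) = P y) -> first f' P' (h x) = omap h (first f P x).
Proof.
move=> PP'; case E: (first f P x) => [y|] /=.
  have [n [-> Py lt_n]] := first_some E; rewrite iter_transport.
  by apply: some_first => [|j lt_j]; rewrite -iter_transport PP' // lt_n.
case E': (first f' P' (h x)) => [y|] //.
have [n [Dy Py _]] := first_some E'.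
by have := first_none E n; rewrite -PP' iter_transport -Dy Py.
Qed.

End Transport.

Section CmapIso.
Variables (m m' : cmap) (h : m -> m').
Hypotheses (h_iso : is_cmap_iso h) (sigma_inj : injective (@sigma m)).

Lemma iso_sigma_inj : injective (@sigma m').
Proof.
case: h_iso => -[h1 hK h1K] hs _ x y.
by rewrite -[x]h1K -[y]h1K -!hs => /(can_inj hK)/sigma_inj ->.
Qed.

Lemma iso_finv e : h (finv (@sigma m) e) = finv (@sigma m') (h e).
Proof.
case: h_iso => _ hs _; apply: iso_sigma_inj.
by rewrite -hs !f_finv //; apply: iso_sigma_inj.
Qed.

Lemma iso_phi e : h (phi e) = phi (h e).
Proof. by case: h_iso => _ _ ha; rewrite /phi iso_finv ha. Qed.

End CmapIso.

Lemma pointed_iso_refl k (q : pointed_map k) : pointed_iso q q.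
Proof.
exists id; split; first by split=> //; exists id.
  by move=> i; rewrite imset_id.
by exists 0 => i; rewrite addr0.
Qed.

Lemma labeled_iso_refl k (m : labeled_map k) : labeled_iso m m.
Proof.
exists id; split; first by split=> //; exists id.
  by move=> i; rewrite imset_id.
by exists 0 => i; rewrite addr0.
Qed.

Section LinkedIso.
Variable k : nat.
Implicit Types (q : pointed_map k) (m : labeled_map k).

Lemma linked_iso_labeled q m m' l t c : @linked k q m l t c -> labeled_iso m m' ->
  exists t' c', @linked k q m' l t' c'.
Proof.
move=> lk [h [h_iso hfac [c0 hlab]]]; have cl := lk_core lk.
have [[h1 hK h1K] hs ha] := h_iso; have h_inj := can_inj hK.
have hphi := iso_phi h_iso (cl_sigma_inj cl).
exists (t \o h1), (c - c0); split; first split.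
- exact: cl_quad cl.
- exact: inj_comp (cl_inj cl) (can_inj h1K).
- by move=> e; apply: cl_down cl _.
- by move=> d /(cl_onto cl)[e <-]; exists (h e); rewrite /= hK.
- by move=> e; rewrite /= -{2}[e]h1K hlab (cl_lab cl); lia.
- by move=> e; rewrite /= (cl_sigma cl) -{2}[e]h1K -hs hK.
- by move=> e; rewrite /= -{1}[e]h1K -ha hK (cl_alpha cl).
- exact: lk_src lk.
- exact: lk_src_inj lk.
- exact: lk_src_min lk.
- exact: lk_delay lk.
move=> i e; rewrite hfac; split.
  case/imsetP=> a /(lk_fac lk)[z [az zi]] ->; exists (h z).
  by rewrite (fconnect_transport h_inj hphi) /= hK.
case=> z [ez zi]; apply/imsetP; exists (h1 e); last by rewrite h1K.
apply/(lk_fac lk); exists (h1 z); split=> //.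
by rewrite -(fconnect_transport h_inj hphi) !h1K.
Qed.

Lemma linked_iso_pointed q q' m l t c : @linked k q m l t c -> pointed_iso q q' ->
  exists l' t' c', @linked k q' m l' t' c'.
Proof.
move=> lk [h [h_iso hsrc [c0 hdelay]]]; have cl := lk_core lk; have lq := cl_quad cl.
have [[h1 hK h1K] hs ha] := h_iso; have h_inj := can_inj hK.
have hphi := iso_phi h_iso (lq_sigma lq).
pose l' x := l (h1 x) + c0; have l'h x : l' (h x) = l x + c0 by rewrite /l' hK.
have down_h x : down l' (h x) = down l x by rewrite /down -ha !l'h; lia.
have ind (P : q' -> Prop) : (forall x, P (h x)) -> forall x, P x.
  by move=> Ph x; rewrite -[x]h1K.
have src_h i x : (h x \in src q' i) = (x \in src q i) by rewrite hsrc mem_imset.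
exists l', (h \o t), (c + c0); split; first split; first split.
- exact: iso_sigma_inj h_iso (lq_sigma lq).
- by apply: ind => x; rewrite -!ha (lq_alpha lq).
- by apply: ind => x; rewrite -hs !l'h (lq_lab lq).
- by apply: ind => x; rewrite -ha !l'h; case: (lq_adj lq x) => ->; [left | right]; lia.
- by apply: ind => x; rewrite -!hphi (lq_face4 lq).
- by apply: ind => x; rewrite -!hphi (inj_eq h_inj) (lq_face2 lq).
- exact: inj_comp h_inj (cl_inj cl).
- by move=> e; rewrite /= down_h (cl_down cl).
- by apply: ind => x; rewrite down_h => /(cl_onto cl)[e <-]; exists e.
- by move=> e; rewrite /= l'h (cl_lab cl) addrA.
- by move=> e; rewrite /= -hs (first_transport hs _ down_h) (cl_sigma cl).
- move=> e; rewrite /= (cl_alpha cl) -[alpha (h (t e))]ha ha /mate -!hphi !down_h.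
  by congr alpha; case: ifP => // _; case: ifP.
- by move=> i; have [x Dx] := lk_src lk i; exists (h x); apply/setP; apply: ind => y;
    rewrite src_h Dx !inE (fconnect_transport h_inj hs).
- move=> i j Dij; apply: (lk_src_inj lk); apply/setP=> x.
  by rewrite -!src_h Dij.
- apply: (ind _) => x; split=> [[i]|up].
    rewrite src_h => xi; apply: ind => y; rewrite (fconnect_transport h_inj hs) down_h.
    by apply: (proj1 (lk_src_min lk x)); exists i.
  have [|i xi] := proj2 (lk_src_min lk x); last by exists i; rewrite src_h.
  by move=> y xy; rewrite -down_h up // (fconnect_transport h_inj hs).
- by move=> i; apply: ind => x; rewrite src_h l'h hdelay => /(lk_delay lk) ->.
move=> i e; split=> [/(lk_fac lk)[z [ez zi]]|[z [ez zi]]]; last apply/(lk_fac lk);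
  by exists z; move: zi; rewrite /= -ha src_h.
Qed.

(** By induction on the number of half-edges with smaller l'-label. If a half-edge at the origin of
    x descends for l', the bound holds at its end, and going back l gains at most 1 while l' gains
    1. Otherwise x belongs to a source, where both labels are the delay. *)
Lemma linked_label_le q m m' l l' t t' c c' :
  @linked k q m l t c -> @linked k q m' l' t' c' -> forall x, l x <= l' x.
Proof.
move=> lk lk' x; have lq := cl_quad (lk_core lk); have lq' := cl_quad (lk_core lk').
move: {2}_.+1 (ltnSn #|[set y | l' y < l' x]|) => n.
elim: n x => // n IHn x; rewrite ltnS => le_n.
case: (pickP (fun y => fconnect (@sigma q) x y && down l' y)) => [y|none].
  case/andP=> xy dy; have Dy := lab_orbit lq xy; have Dy' := lab_orbit lq' xy.
  have Da := lq_lab_down dy; have : l (alpha y) <= l' (alpha y).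
    apply: IHn; apply: leq_trans le_n; apply: proper_card; apply/properP; split.
      by apply/subsetP=> z; rewrite !inE; lia.
    by exists (alpha y); rewrite !inE ?ltxx //; lia.
  by case: (lq_adj lq y); lia.
have [|i xi] := proj2 (lk_src_min lk' x).
  by move=> y xy; have := none y; rewrite xy /= => ->.
by rewrite (lk_delay lk xi) (lk_delay lk' xi).
Qed.

Lemma linked_label_eq q m m' l l' t t' c c' :
  @linked k q m l t c -> @linked k q m' l' t' c' -> l = l'.
Proof.
move=> lk lk'; apply: boolp.funext => x; apply/eqP; rewrite eq_le.
by rewrite (linked_label_le lk lk') (linked_label_le lk' lk).
Qed.

Lemma linked_labeled_iso q m m' l l' t t' c c' :
  @linked k q m l t c -> @linked k q m' l' t' c' -> labeled_iso m m'.
Proof.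
move=> lk; move=> /[dup] lk' /(linked_label_eq lk) Dl; rewrite -{l'}Dl in lk'.
have cl := lk_core lk; have cl' := lk_core lk'.
have [e|] := @fin_all_exists m (fun _ => m') (fun e e' => t' e' = t e).
  exact: (cl_onto cl' (cl_down cl e)).
move=> h ht; have [e|] := @fin_all_exists m' (fun _ => m) (fun e e' => t e' = t' e).
  exact: (cl_onto cl (cl_down cl' e)).
move=> h1 h1t; have hK : cancel h h1 by move=> e; apply: (cl_inj cl); rewrite h1t ht.
have h1K : cancel h1 h by move=> e; apply: (cl_inj cl'); rewrite ht h1t.
have h_iso : is_cmap_iso h.
  split; first by exists h1.
    move=> e; apply: (cl_inj cl'); rewrite ht; apply: Some_inj.
    by rewrite -(cl_sigma cl') -(cl_sigma cl) ht.
  by move=> e; apply: (cl_inj cl'); rewrite ht (cl_alpha cl) (cl_alpha cl') ht.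
have hphi := iso_phi h_iso (cl_sigma_inj cl).
exists h; split=> // [i|]; last first.
  by exists (c - c') => e; have := cl_lab cl' (h e); rewrite ht (cl_lab cl); lia.
apply/setP=> e; rewrite -[e]h1K (mem_imset _ _ (can_inj hK)).
apply/idP/idP => [/(lk_fac lk')|/(lk_fac lk)] [z [ez zi]].
  apply/(lk_fac lk); exists (h1 z).
  by rewrite h1t -(fconnect_transport (can_inj hK) hphi) [h (h1 z)]h1K.
apply/(lk_fac lk'); exists (h z).
by rewrite ht (fconnect_transport (can_inj hK) hphi).
Qed.

End LinkedIso.

(** * Recovering the quadrangulation from the labeled map *)

Section FacesFromMap.
Variables (q m : cmap) (l : q -> int) (lb : m -> int) (t : m -> q) (c : int).
Hypothesis cl : core_link l lb t c.
Implicit Types (e z : m) (x y : q).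

Let lq := cl_quad cl.
Let t_inj := cl_inj cl.
Let alphaK := lq_alpha lq.
Let alpha_inj := inv_inj alphaK.

Lemma mate_t e : mate l (alpha (t e)) = alpha (t (alpha e)).
Proof. by rewrite (cl_alpha cl) alphaK. Qed.

Lemma l_alpha_t e : l (alpha (t e)) = lb e + c - 1.
Proof. by rewrite (lq_lab_down (cl_down cl e)) (cl_lab cl). Qed.

Lemma down_phi_alpha e : down l (phi (alpha (t e))) = (lb (phi e) != lb e + 1).
Proof.
have up := cl_up cl e; have := mate_t e; move/(congr1 l).
rewrite l_alpha_t (cl_lab_alpha cl); have := l_alpha_t e.
have := up_pattern lq up; set u := alpha (t e) in up *; rewrite !inE /mate.
have := lq_lab_phi lq (phi (phi (phi u))); have := lq_lab_phi lq (phi (phi u)).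
have := lq_lab_phi lq (phi u); have := lq_lab_phi lq u.
rewrite (lq_face4 lq) (negPf up) => l1 l2 l3 l4 /or3P[] /eqP[d1 d2 d3];
  by move: l1 l2 l3 l4; rewrite d1 d2 d3 /=; lia.
Qed.

Lemma phi_up e : phi (alpha (t e)) =
  if lb (phi e) == lb e + 1 then alpha (t (alpha e)) else t (phi (alpha e)).
Proof.
have := down_phi_alpha e; case: eqP => /= _ dphi.
  by rewrite -mate_t /mate dphi.
have := cl_phi cl (alpha e); rewrite (cl_alpha cl) alphaK (mateK lq) ?(cl_up cl) //.
by rewrite (lq_descent_rec lq) dphi => -[].
Qed.

Lemma descent_lower e : descent l (t e) = omap t (lower (@phi m) lb e).
Proof. by case: (descentP cl e). Qed.

Lemma phi_first e : lb (phi e) = lb e + 1 ->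
  phi (phi (alpha (t e))) = t (phi e)
  /\ Some (phi (phi (phi (alpha (t e))))) = omap t (lower (@phi m) lb (phi e)).
Proof.
move=> Dl; case: (phiP cl e) => [_ _ D1 D _ _|_ _ _|_ _]; try by rewrite Dl; lia.
by rewrite -descent_lower D.
Qed.

Lemma phi_confluent e : lb (phi e) = lb e ->
  phi (phi (phi (alpha (t e)))) = t (phi e).
Proof.
move=> Dl; case: (phiP cl e) => [_ _ _ _ _|_ -> //|_ _]; by rewrite Dl; lia.
Qed.

(** A descending side is the third or fourth side of a simple face counted from its first ascent, or
    the fourth side of a confluent face counted from one of its two ascents. The labels of m tell
    these cases apart. *)
Lemma down_cover x : down l x -> exists e, let u := alpha (t e) in
  [\/ lb (phi e) = lb e + 1 /\ x = phi (phi u),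
      lb (phi e) = lb e + 1 /\ x = phi (phi (phi u))
    | lb (phi e) = lb e /\ x = phi (phi (phi u))].
Proof.
move=> dx; have F4 := lq_face4 lq.
have up_t y : ~~ down l y -> exists e, y = alpha (t e).
  rewrite -(lq_up_alpha lq) => /(cl_onto cl)[e De]; exists e.
  by rewrite De alphaK.
case: (boolP (down l (phi x))) => [dpx|/up_t[e De]].
  case: (boolP (down l (phi (phi x)))) => [dppx|/[dup] uppx /up_t[e De]].
    have := lq_lab_phi lq (phi (phi (phi x))); have := lq_lab_phi lq (phi (phi x)).
    have := lq_lab_phi lq (phi x); have := lq_lab_phi lq x.
    by rewrite F4 dx dpx dppx; case: down; lia.
  exists e => /=; constructor 1; rewrite -De F4; split=> //.
  have := up_pattern lq uppx; rewrite F4 dx dpx.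
  by have := down_phi_alpha e; rewrite -De; case: eqP => //= _ ->.
exists e; rewrite /= -De F4.
case: (cl_lab_phi cl e) => Dl; [by constructor 2 | by constructor 3 | exfalso].
case: (phiP cl e) => [_ _ _ _ _|_ _ _|mu _ _]; try by rewrite Dl; lia.
have := mate_up lq (cl_up cl e); rewrite mu -De F4 dx //.
Qed.

End FacesFromMap.

(** * A bijection compatible with the links commutes with the permutations *)

Section FromMap.
Variables (q q' m : cmap) (l : q -> int) (l' : q' -> int) (lb : m -> int).
Variables (t : m -> q) (t' : m -> q') (c c' : int) (h : q -> q').
Hypotheses (cl : core_link l lb t c) (cl' : core_link l' lb t' c').
Hypotheses (ht : forall e, h (t e) = t' e)
  (hat : forall e, h (alpha (t e)) = alpha (t' e)).

Let lq := cl_quad cl.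
Let lq' := cl_quad cl'.

Lemma half_edge_ind (P : q -> Prop) :
  (forall e, P (t e)) -> (forall e, P (alpha (t e))) -> forall x, P x.
Proof.
move=> Pt Pat x; have [e] := cl_onto cl (downward_down cl x).
by rewrite /downward; case: ifP => _ De; [rewrite -De | rewrite -[x](lq_alpha lq) -De].
Qed.

Lemma from_map_alpha x : h (alpha x) = alpha (h x).
Proof. by move: x; apply: half_edge_ind => e; rewrite ?(lq_alpha lq) ht hat ?(lq_alpha lq'). Qed.

Lemma from_map_phi x : h (phi x) = phi (h x).
Proof.
have F4 := lq_face4 lq; have F4' := lq_face4 lq'.
have phi1 e : lb (phi e) = lb e + 1 ->
    h (phi (phi (alpha (t e)))) = phi (phi (alpha (t' e)))
    /\ h (phi (phi (phi (alpha (t e))))) = phi (phi (phi (alpha (t' e)))).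
  move=> /[dup] /(phi_first cl)[-> D] /(phi_first cl')[-> D'].
  case: (lower (@phi m) lb (phi e)) D D' => [z|] //= [->] [->].
  by rewrite !ht.
move: x; apply: half_edge_ind => e; last first.
  by rewrite hat (phi_up cl) (phi_up cl'); case: ifP; rewrite ?ht ?hat.
have [a] := down_cover cl (cl_down cl e).
case=> -[Dl De]; rewrite De.
- by have [-> ->] := phi1 a Dl.
- by have [_ ->] := phi1 a Dl; rewrite F4 F4' hat.
rewrite F4 hat (phi_confluent cl Dl) ht -(phi_confluent cl' Dl).
by rewrite F4'.
Qed.

Lemma from_map_sigma x : h (sigma x) = sigma (h x).
Proof.
have sK := finv_f (lq_sigma lq).
rewrite -[x in RHS](sK x) (lq_finv_sigma lq) from_map_phi (lq_sigma_phi lq').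
by rewrite from_map_alpha (lq_alpha lq').
Qed.

End FromMap.

Lemma linked_pointed_iso k (q q' : pointed_map k) (m : labeled_map k) l l' t t' c c' :
  @linked k q m l t c -> @linked k q' m l' t' c' -> pointed_iso q q'.
Proof.
have ex_h (p p' : pointed_map k) (lp : p -> int) (lp' : p' -> int) s s' d d' :
    @linked k p m lp s d -> @linked k p' m lp' s' d' ->
    exists h : p -> p', (forall e, h (s e) = s' e)
      /\ (forall e, h (alpha (s e)) = alpha (s' e)).
  move=> lk lk'; have cl := lk_core lk; have lp_quad := cl_quad cl.
  have [x|h Dh] := @fin_all_exists p (fun _ => p') (fun x y =>
      exists2 e, s e = downward lp x & y = if down lp x then s' e else alpha (s' e)).
    by have [e De] := cl_onto cl (downward_down cl x); do 2!eexists; eauto.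
  exists h; split=> e.
    have [a] := Dh (s e); rewrite (downward_t cl) => /(cl_inj cl) ->.
    by rewrite (cl_down cl).
  have [a] := Dh (alpha (s e)); rewrite (downward_alpha cl) (downward_t cl).
  by move/(cl_inj cl) ->; rewrite (negPf (cl_up cl _)).
(* The i-th source is recovered from m: the half-edges of minimal label in the i-th face point at
   it. *)
have src_h (p p' : pointed_map k) (lp : p -> int) (lp' : p' -> int) s s' d d' h :
    @linked k p m lp s d -> @linked k p' m lp' s' d' ->
    (forall e, h (alpha (s e)) = alpha (s' e)) ->
    forall i x, x \in src p i -> h x \in src p' i.
  move=> lk lk' ha i x xi; have cl := lk_core lk; have lp_quad := cl_quad cl.
  have [|e De] := cl_onto cl (d := alpha x).
    by rewrite (lq_up_alpha lp_quad) (src_up lk xi).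
  have Dx : x = alpha (s e) by rewrite De (lq_alpha lp_quad).
  rewrite Dx ha in xi *; apply: (fac_src lk'); first exact: src_minimal lk _ _ xi.
  exact: src_fac lk _ _ xi.
move=> lk lk'; have cl := lk_core lk; have cl' := lk_core lk'.
have [h [ht hat]] := ex_h _ _ _ _ _ _ _ _ lk lk'.
have [h1 [h1t h1at]] := ex_h _ _ _ _ _ _ _ _ lk' lk.
have hK : cancel h h1 by apply: (half_edge_ind cl) => e; rewrite ?ht ?hat ?h1t ?h1at.
have h1K : cancel h1 h by apply: (half_edge_ind cl') => e; rewrite ?h1t ?h1at ?ht ?hat.
exists h; split.
- split; first by exists h1.
    exact: from_map_sigma cl cl' ht hat.
  exact: from_map_alpha cl cl' ht hat.
- move=> i; apply/setP=> x; rewrite -[x]h1K (mem_imset _ _ (can_inj hK)).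
  apply/idP/idP => [|xi]; last exact: src_h lk lk' hat _ _ xi.
  by move/(src_h _ _ _ _ _ _ _ _ h1 lk' lk h1at); rewrite hK.
(* A source has label one less than the minimal label z of its face, shifted by c in q and by c' in
   q'. *)
exists (c' - c) => i; have [z _ zi] := src_minimal_exists lk i.
have zi' := src_h _ _ _ _ _ _ _ _ _ lk lk' hat _ _ zi; rewrite hat in zi'.
rewrite -(lk_delay lk zi) -(lk_delay lk' zi') (l_alpha_t cl) (l_alpha_t cl').
by rewrite addrCA; lia.
Qed.

(** * The construction Psi *)

Lemma minseq_le (s : seq int) x : x \in s -> minseq s <= x.
Proof.
rewrite /minseq; move: (head 0 s) => y; elim: s => //= z s IHs.
rewrite inE => /predU1P[->|/IHs]; first by rewrite ge_min lexx.
by rewrite ge_min orbC => ->.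
Qed.

Lemma minseq_in (s : seq int) : s != [::] -> minseq s \in s.
Proof.
have fold_in y (r : seq int) : foldr Num.min y r \in y :: r.
  elim: r => [|z r IHr] /=; first exact: mem_head.
  rewrite minElt; case: ifP => _; first by rewrite !inE eqxx orbT.
  by move: IHr; rewrite !inE => /orP[]->; rewrite ?orbT.
rewrite /minseq; case: s => // z s _ /=; rewrite minElt; case: ifP => _ //.
exact: mem_head.
Qed.

(** * The distance labels of a pointed quadrangulation *)

Section QLabel.
Variables (g k : nat) (q : pointed_map k).
Hypotheses (hk : (0 < k)%N) (qQ : is_Q g q).
Implicit Types (x y : q) (v : {set q}) (i j : 'I_k).

Let q_map : is_map q. Proof. by case: qQ => -[]. Qed.
Let srcV i : src q i \in vertices q. Proof. by case: qQ => _ _ _ [-> //]. Qed.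
Let sigma_inj : injective (@sigma q) := map_sigma_inj q_map.
Let alphaK : involutive (@alpha q) := map_alphaK q_map.

Lemma Q_strict i j : i != j ->
  `|delay q i - delay q j| < (dist (src q i) (src q j))%:Z.
Proof. by case: qQ => _ _ _ [_ strict _]; apply: strict. Qed.

Lemma vlabel_le i v : vlabel v <= delay q i + (dist v (src q i))%:Z.
Proof. by apply: minseq_le; apply/imageP; exists i. Qed.

Lemma vlabel_arg v : exists i, vlabel v = delay q i + (dist v (src q i))%:Z.
Proof.
have : vlabel v \in [seq delay q i + (dist v (src q i))%:Z | i : 'I_k].
  by apply: minseq_in; rewrite -size_eq0 size_image card_ord -lt0n.
by case/imageP=> i _ ->; exists i.
Qed.

(** By the strict inequalities on delays, no other source gives a smaller value there. *)
Lemma vlabel_src i : vlabel (src q i) = delay q i.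
Proof.
apply/eqP; rewrite eq_le; apply/andP; split.
  by have := vlabel_le i (src q i); rewrite dist0 // addr0.
have [j ->] := vlabel_arg (src q i); have [->|/Q_strict] := eqVneq i j; lia.
Qed.

Lemma elabel_lipschitz x : elabel x <= elabel (alpha x) + 1.
Proof.
have [i Di] := vlabel_arg (org (alpha x)).
rewrite /elabel Di; apply: le_trans (vlabel_le i _) _.
by have := dist_edge q_map x (srcV i); lia.
Qed.

(** The parity of a distance depends on the colours of its ends only, and the evenness condition
    ties delays to the colours of the sources; so colour and label have the same parity up to a
    constant. *)
Lemma vlabel_parity : exists2 c : {set q} -> bool,
    forall x, c (org x) != c (tgt x)
  & exists d, forall x, exists z, elabel x = d + (c (org x) : nat)%:Z + 2 * z.
Proof.
case: qQ => _ _ [c c_adj] [_ _ even_d]; exists c => //.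
have odd_walk n x y : walk n (org x) (org y) -> odd n = (c (org x) (+) c (org y)).
  case/walkP=> p [<-]; elim: p x {n} => [|w p IHp] x /=.
    by move=> _ ->; rewrite addbb.
  case/andP=> /existsP[e /andP[/eqP <- /eqP <-]] pathp lastp.
  rewrite (IHp _ pathp lastp); move: (c_adj e); rewrite /tgt.
  by case: (c _); case: (c _); case: (c _).
have i0 : 'I_k := Ordinal hk; have [x0 _ Dx0] := imsetP (srcV i0).
exists (delay q i0 + (c (org x0) : nat)%:Z) => x.
have [i Di] := vlabel_arg (org x); rewrite /elabel {}Di.
have [xi _ Dxi] := imsetP (srcV i).
have wx : walk (dist (org x) (src q i)) (org x) (src q i).
  by apply: walk_dist => //; apply: org_vertices.
have wi : walk (dist (src q i) (src q i0)) (src q i) (src q i0) by apply: walk_dist.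
have [/dvdzP[z Dz] _] := even_d i i0.
rewrite Dxi Dx0 in wx wi Dz *; have := odd_walk _ _ _ wx; have := odd_walk _ _ _ wi.
move: Dz; set d1 := dist (org x) _; set d2 := dist (org xi) _ => Dz o2 o1.
have := odd_double_half d1; have := odd_double_half d2; rewrite o1 o2 {o1 o2} => D2 D1.
(* The division by 2 is exact: modulo 2, each of the three colours enters its numerator twice. *)
exists (z - d2./2%:Z + d1./2%:Z + (((c (org x) (+) c (org xi) : nat)%:Z
  - (c (org xi) (+) c (org x0) : nat)%:Z - (c (org x0) : nat)%:Z
  - (c (org x) : nat)%:Z) %/ 2)%Z).
by move: Dz D2 D1; case: (c (org x)); case: (c (org xi)); case: (c (org x0)) => /=; lia.
Qed.

Lemma elabel_adj x : elabel (alpha x) = elabel x + 1 \/ elabel (alpha x) = elabel x - 1.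
Proof.
have [c c_adj [d par]] := vlabel_parity.
have := elabel_lipschitz x; have := elabel_lipschitz (alpha x); rewrite alphaK.
have [z Dz] := par x; have [z' Dz'] := par (alpha x).
move: Dz Dz' (c_adj x); rewrite /tgt.
by case: (c _); case: (c _) => //=; lia.
Qed.

Lemma elabel_sigma x : elabel (sigma x) = elabel x.
Proof. by rewrite /elabel org_sigma. Qed.

Lemma elabel_lquad : lquad (@elabel k q).
Proof.
have lab_phi x : elabel (phi x) = elabel (alpha x).
  by rewrite -elabel_sigma /phi f_finv.
have phi_inj : injective (@phi q).
  move=> x y /(congr1 (@sigma q)); rewrite /phi !f_finv //; exact: (inv_inj alphaK).
have ord4 x : order (@phi q) x = 4%N.
  have [_ quad _ _] := qQ; rewrite -(quad (face_of x)) ?imset_f //.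
  by rewrite /order; apply: eq_card => y; rewrite [in RHS]inE.
split=> // [||x|x]; first exact: elabel_sigma.
- exact: elabel_adj.
- by have := iter_order phi_inj x; rewrite ord4.
apply/eqP=> Dx; have cyc : fcycle (@phi q) [:: x; phi x] by rewrite /= Dx !eqxx.
have up : uniq [:: x; phi x].
  rewrite /= inE andbT; apply/eqP=> Dx1; have := lab_phi x; rewrite -Dx1.
  by case: (elabel_adj x) => ->; lia.
by have := order_cycle cyc up (mem_head _ _); rewrite ord4.
Qed.

Lemma src_org_Q i x : x \in src q i -> src q i = org x.
Proof.
case/imsetP: (srcV i) => y _ -> xy; apply/eqP.
by rewrite (org_eq _ _ sigma_inj).
Qed.

Lemma elabel_src i x : x \in src q i -> elabel x = delay q i.
Proof. by move/src_org_Q => Di; rewrite /elabel -Di vlabel_src. Qed.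

Lemma src_injQ : injective (src q).
Proof.
move=> i j Dij; apply/eqP/negPn/negP => /Q_strict.
by rewrite Dij dist0 //; lia.
Qed.

(** A descent from a source would bring another source too close for the strict inequality.
    Conversely, a nonempty geodesic to a source realising the minimum begins with a descent. *)
Lemma src_minQ x : (exists i, x \in src q i) <->
  (forall y, fconnect (@sigma q) x y -> ~~ down (@elabel k q) y).
Proof.
have lq := elabel_lquad; split=> [[i xi] y xy|up].
  apply/negP=> /lq_lab_down dy; have Dy := lab_orbit lq xy.
  have Di := elabel_src xi; have [j] := vlabel_arg (tgt y).
  rewrite -[vlabel _]/(elabel (alpha y)) dy Dy Di => Dj.
  have := dist_edge q_map y (srcV j).
  rewrite (_ : org y = src q i); last first.
    by rewrite (src_org_Q xi); apply/eqP; rewrite eq_sym (org_eq _ _ sigma_inj) inE.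
  have [Dij|/Q_strict] := eqVneq i j; first by move: Dj; rewrite Dij; lia.
  by rewrite /tgt in Dj; lia.
have [i Di] := vlabel_arg (org x); exists i.
have : walk (dist (org x) (src q i)) (org x) (src q i).
  by apply: walk_dist => //; apply: org_vertices.
case/walkP=> [[|w p] [Dn /= pathp lastp]]; first by rewrite -lastp org_in.
case/andP: pathp => /existsP[y /andP[/eqP Dy /eqP Dw]] pathp.
have xy : fconnect (@sigma q) x y by have := org_in y; rewrite Dy inE.
have := up y xy; rewrite /down => /eqP[]; apply/eqP; rewrite eq_le.
have := vlabel_le i (tgt y); have := elabel_lipschitz y.
have : (dist (tgt y) (src q i) <= size p)%N.
  apply: dist_le; first exact: org_vertices.
  by apply/walkP; exists p; rewrite Dw.
rewrite /elabel /tgt Dy Di -Dn /= => *; apply/andP; split; lia.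
Qed.

End QLabel.

Lemma set2_eq (T : finType) (x y a b : T) : a != b -> [set x; y] = [set a; b] ->
  (x = a /\ y = b) \/ (x = b /\ y = a).
Proof.
move=> ne_ab Dxy.
have b_xy : b \in [set x; y] by rewrite Dxy set22.
have a_xy : a \in [set x; y] by rewrite Dxy set21.
rewrite !inE in a_xy b_xy; have := set21 x y; have := set22 x y; rewrite Dxy !inE.
case/orP=> /eqP Dy /orP[]/eqP Dx; rewrite ?Dx ?Dy; try by [left | right].
  by move: b_xy; rewrite Dx Dy orbb eq_sym (negPf ne_ab).
by move: a_xy; rewrite Dx Dy orbb (negPf ne_ab).
Qed.

(** * Chords and the half-edges of the new map *)

Section Chords.
Variables (k : nat) (q : pointed_map k).
Hypothesis lq : lquad (@elabel k q).
Implicit Types (c e u : q).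

Let dn := down (@elabel k q).

Lemma simple_atP e :
  simple_at e = [&& ~~ dn e, ~~ dn (phi e) & dn (phi (phi e))].
Proof.
rewrite /simple_at /= !eqseq_cons andbT.
have := lq_lab_phi lq e; have := lq_lab_phi lq (phi e).
have := lq_lab_phi lq (phi (phi e)); rewrite -/dn.
by case: (dn e); case: (dn (phi e)); case: (dn (phi (phi e))) => /=; lia.
Qed.

Lemma confluent_atP e :
  confluent_at e = [&& ~~ dn e, dn (phi e) & ~~ dn (phi (phi e))].
Proof.
rewrite /confluent_at /= !eqseq_cons andbT.
have := lq_lab_phi lq e; have := lq_lab_phi lq (phi e).
have := lq_lab_phi lq (phi (phi e)); rewrite -/dn.
by case: (dn e); case: (dn (phi e)); case: (dn (phi (phi e))) => /=; lia.
Qed.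

(** In both kinds of faces the chord joins the two corners that follow the ascending sides, which
    makes them a single case. *)
Lemma chordP c c' : chord c c' <->
  exists2 u, ~~ dn u & c = phi u /\ c' = phi (mate (@elabel k q) u).
Proof.
have phi_inj := lq_phi_inj lq; have F4 := lq_face4 lq; have F2 := lq_face2 lq.
split=> [/orP[]/existsP[e /andP[]]|[u up [-> ->]]].
- rewrite simple_atP => /and3P[up up1 _] /eqP/set2_eq[|[-> ->]|[-> ->]].
  + by rewrite eq_sym (lq_phi_neq lq).
  + by exists e; rewrite // /mate up1.
  have Dm : mate (@elabel k q) e = phi e by rewrite /mate up1.
  by exists (phi e) => //; rewrite -{4}Dm (mateK lq).
- rewrite confluent_atP => /and3P[up d1 up2] /eqP/set2_eq[|[-> ->]|[-> ->]].
  + by rewrite eq_sym F2.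
  + by exists e; rewrite // /mate [down _ _]d1 up2.
  have Dm : mate (@elabel k q) e = phi (phi e) by rewrite /mate [down _ _]d1 up2.
  by exists (phi (phi e)) => //; rewrite -{3}Dm (mateK lq).
apply/orP; have := up_pattern lq up; rewrite !inE => /or3P[] /eqP[d1 d2 d3].
- left; apply/existsP; exists u.
  by rewrite simple_atP /dn d1 d2 up /mate d1 eqxx.
- right; apply/existsP; exists u.
  by rewrite confluent_atP /dn d1 d2 up /mate d1 d2 eqxx.
(* Here u is the second ascent of a simple face, whose lowest corner is that of the first ascent. *)
left; apply/existsP; exists (phi (phi (phi u))).
by rewrite simple_atP /mate d1 d2 /= !F4 /dn d1 d3 up setUC eqxx.
Qed.

Lemma chordedP c : chorded c = dn (sigma c).
Proof.
apply/existsP/idP => [[c' /chordP[u up [-> _]]]|dc].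
  by rewrite (lq_sigma_phi lq) /dn (lq_up_alpha lq).
exists (phi (mate (@elabel k q) (alpha (sigma c)))); apply/chordP.
exists (alpha (sigma c)); first by rewrite /dn (lq_up_alpha lq) negbK.
by split=> //; rewrite -(lq_finv_sigma lq) (finv_f (lq_sigma lq)).
Qed.

Lemma same_region_face_step :
  @same_region k q =2 face_step (@elabel k q).
Proof.
have chorded_phi x : ~~ chorded (phi x) = dn x.
  by rewrite chordedP (lq_sigma_phi lq) /dn (lq_up_alpha lq) negbK.
move=> x y; rewrite /same_region /face_step; congr [|| _, _ | _].
  by case: eqP => [->|]; rewrite ?andbF // chorded_phi andbT.
by case: eqP => [->|]; rewrite ?andbF // chorded_phi andbT.
Qed.

Definition psi_t (c : psi q) : q := sigma (val c).

Lemma psi_t_down (c : psi q) : dn (psi_t c).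
Proof. by rewrite -chordedP; apply: (valP c). Qed.

Lemma psi_t_onto d : dn d -> exists c : psi q, psi_t c = d.
Proof.
move=> dd; have ch : chorded (finv (@sigma q) d).
  by rewrite chordedP (f_finv (lq_sigma lq)).
by exists (Sub _ ch : psi_dart q); rewrite /psi_t SubK (f_finv (lq_sigma lq)).
Qed.

Lemma val_psi_sigma (c : psi q) :
  Some (val (sigma c)) = first (@sigma q) (@chorded k q) (sigma (val c)).
Proof.
rewrite -(next_first (lq_sigma lq) (valP c)).
have <- : map val (pmap insub (orbit (@sigma q) (val c)) : seq (psi_dart q)) =
    [seq y <- orbit (@sigma q) (val c) | chorded y].
  by rewrite (pmap_filter (insubK _)); apply: eq_filter => x; apply: isSome_insub.
by rewrite (next_map val_inj) // pmap_sub_uniq ?orbit_uniq.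
Qed.

Lemma val_psi_alpha (c : psi q) :
  val (alpha c) = phi (mate (@elabel k q) (alpha (psi_t c))).
Proof.
set u := alpha (psi_t c); have up : ~~ dn u.
  by rewrite /u /dn (lq_up_alpha lq) negbK; apply: psi_t_down.
have Dc : val c = phi u by rewrite /u -(lq_finv_sigma lq) (finv_f (lq_sigma lq)).
rewrite /= /psi_alpha; case: pickP => [c'|none] /=.
  case/chordP=> u' _ [Du' ->]; rewrite Dc in Du'.
  by rewrite (lq_phi_inj lq Du').
have ch : chorded (phi (mate (@elabel k q) u)).
  by rewrite chordedP (lq_sigma_phi lq) /dn (lq_up_alpha lq) (mate_up lq).
have := none (Sub _ ch : psi_dart q); rewrite SubK.
by have -> //: chord (val c) (phi (mate (@elabel k q) u)); apply/chordP; exists u.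
Qed.

Lemma psi_core_link :
  core_link (@elabel k q) (@lab k (psi q)) psi_t 0.
Proof.
split=> //.
- by move=> c c' /(lq_sigma lq)/val_inj.
- exact: psi_t_down.
- exact: psi_t_onto.
- by move=> c; rewrite /psi_t (lq_lab lq) addr0.
- have ch y : dn (sigma y) = chorded y by rewrite chordedP.
  (* Corners are shifted to their descending half-edges by [sigma], which commutes with itself and
     so preserves first returns. *)
  have tr := @first_transport q q (@sigma q) (@sigma q) (@sigma q)
    (fun x => erefl (sigma (sigma x))).
  by move=> c; rewrite /psi_t (tr _ _ _ ch) -val_psi_sigma.
by move=> c; rewrite {1}/psi_t val_psi_alpha (lq_sigma_phi lq).
Qed.

End Chords.

Lemma psi_linked (g k : nat) (q : pointed_map k) : (0 < k)%N -> is_Q g q ->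
  linked (@elabel k q) (@psi_t k q) 0.
Proof.
move=> hk qQ; have lq := elabel_lquad hk qQ; have cl := psi_core_link lq.
have phiK (c : psi q) : phi (alpha (psi_t c)) = val c.
  by rewrite -(lq_finv_sigma lq) (finv_f (lq_sigma lq)).
split=> //.
- by move=> i; case: qQ => _ _ _ [/(_ i)/imsetP[x _ ->] _ _]; exists x.
- exact: src_injQ qQ.
- exact: src_minQ hk qQ.
- exact: elabel_src hk qQ.
move=> i c; rewrite inE; split=> [/existsP[e]|[z [cz zi]]].
  case/andP=> /eqP De /existsP[e' /andP[e'i]].
  rewrite (eq_connect (same_region_face_step lq)) => ee'.
  have ue' : ~~ down (@elabel k q) e'.
    by apply: (proj1 (src_minQ hk qQ e')); [exists i | apply: connect0].
  have [|z Dz] := cl_onto cl (d := alpha e'); first by rewrite (lq_up_alpha lq).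
  exists z; rewrite Dz (lq_alpha lq); split=> //.
  apply: (connect_face_step cl ee').
    rewrite (_ : e = alpha (psi_t c)) ?(downward_alpha cl) ?(downward_t cl) //.
    by apply: (lq_phi_inj lq); rewrite phiK.
  by rewrite Dz /downward (negPf ue').
apply/existsP; exists (alpha (psi_t c)); rewrite phiK eqxx /=.
apply/existsP; exists (alpha (psi_t z)); rewrite zi /=.
rewrite (eq_connect (same_region_face_step lq)).
apply: connect_trans (connect_trans (fconnect_face_step cl cz) (face_step_alpha _ _)).
by rewrite -{2}[psi_t c](lq_alpha lq); apply: face_step_alpha.
Qed.

(** * The construction Phi *)

(** The nested defaults are the wrap-around: a last h is followed by the head of the list, which is
    h itself if a is empty. *)
Lemma next_split (T : eqType) (a b : seq T) h : h \notin a ->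
  next (a ++ h :: b) h = head (head h a) b.
Proof.
case: a => [|y a]; first by case: b => [|z b] /=; rewrite eqxx.
rewrite /= inE negb_or => /andP[ne_hy]; move: {1 3}y ne_hy => y'.
elim: a y' => [|z a IHa] y' ne_hy' /=.
  by rewrite (negPf ne_hy'); case: b => [|z b] /=; rewrite eqxx.
by rewrite (negPf ne_hy') inE negb_or => /andP[ne_hz ha]; apply: IHa.
Qed.

Section PhiMap.
Variables (g k : nat) (m : labeled_map k).
Hypothesis mLM : is_LM g m.
Implicit Types (e c x y z w : m) (h : phi_dart m) (i : 'I_k).

Notation lb := (@lab k m).
Notation S := (@phi_sigma k m).

Let m_map : is_map m. Proof. by case: mLM => -[]. Qed.
Let sigma_inj : injective (@sigma m) := map_sigma_inj m_map.
Let alphaK : involutive (@alpha m) := map_alphaK m_map.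

Lemma LM_sigma_phi e : sigma (phi e) = alpha e.
Proof. by rewrite /phi f_finv. Qed.

Let phi_inj : injective (@phi m).
Proof.
apply: (can_inj (g := fun e => alpha (sigma e))) => e.
by rewrite LM_sigma_phi alphaK.
Qed.

Lemma LM_phi_alpha e : sigma (phi (alpha e)) = e.
Proof. by rewrite LM_sigma_phi alphaK. Qed.

Lemma LM_lab_sigma e : lb (sigma e) = lb e.
Proof. by case: mLM => _ _ _ []. Qed.

Lemma LM_lab_phi e : lb (phi e) = lb (alpha e).
Proof. by rewrite -LM_lab_sigma LM_sigma_phi. Qed.

Lemma LM_lab_phi_alpha e : lb (phi (alpha e)) = lb e.
Proof. by rewrite LM_lab_phi alphaK. Qed.

Lemma LM_lab_step e : lb e - 1 <= lb (phi e) <= lb e + 1.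
Proof.
rewrite LM_lab_phi; case: mLM => _ _ _ [_ /(_ e)] le1; apply/andP; split; lia.
Qed.

(** The test on [face_min] agrees with the search, which finds nothing below a minimal label. *)
Lemma succE e : succ e = lower (@phi m) lb e.
Proof.
rewrite /succ; case: eqP => // De; rewrite /lower; case E: (first _ _ _) => [z|] //.
have ez := first_fconnect E; have := first_in E; rewrite De.
have: face_min (face_of e) <= lb z by apply: minseq_le; apply/image_f; rewrite inE.
by move=> le /eqP; lia.
Qed.

Lemma succP e : lower_spec (@phi m) lb e (succ e).
Proof. by rewrite succE; apply: lowerP => y; case/andP: (LM_lab_step y). Qed.

Lemma succ_none e : succ e = None <-> face_minimal lb e.
Proof.
by case: succP => [min_e|n Dn _]; split=> // /(_ n); rewrite Dn; lia.
Qed.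

Lemma succ_lab e c : succ e = Some c -> lb c = lb e - 1.
Proof. by case: succP => // n Dn _ [<-]. Qed.

Lemma face_minimal_min e : face_minimal lb e -> face_min (face_of e) = lb e.
Proof.
move=> min_e; apply/eqP; rewrite eq_le; apply/andP; split.
  by apply/minseq_le/image_f; rewrite inE connect0.
have : face_min (face_of e) \in [seq lb z | z in face_of e].
  apply: minseq_in; rewrite -size_eq0 size_image -lt0n; apply/card_gt0P.
  by exists e; rewrite inE connect0.
by case/imageP=> z; rewrite inE => /iter_findex <- ->.
Qed.

Definition preds c := [seq x <- orbit (@phi m) c | succ x == Some c].

(** The default of [head] covers a vertex with the single corner c: then s is empty and [sigma c] is
    c. *)
Lemma around_oldE c : exists2 s : seq (phi_dart m),
  around_old c = corner_darts c ++ s & head (c, true) s = (sigma c, true).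
Proof.
exists (flatten [seq corner_darts z | z <- traject (@sigma m) (sigma c) (order (@sigma m) c).-1]).
  by rewrite /around_old /orbit -orderSpred.
case E: (order (@sigma m) c).-1 => [|n] //=.
by rewrite -{1}(iter_order sigma_inj c) -orderSpred E.
Qed.

Lemma phi_sigma_true c :
  S (c, true) = if preds c is x :: _ then (x, false) else (sigma c, true).
Proof.
rewrite /phi_sigma; have [s -> Ds] := around_oldE c; rewrite /corner_darts cat_cons.
rewrite (@next_split _ [::]) //= -/(preds c).
by case: (preds c).
Qed.

Lemma phi_sigma_false c a x b : preds c = a ++ x :: b ->
  S (x, false) = if b is y :: _ then (y, false) else (sigma c, true).
Proof.
move=> Dp; have up : uniq (preds c) by apply/filter_uniq/orbit_uniq.
have /eqP sx : succ x == Some c.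
  have : x \in preds c by rewrite Dp mem_cat mem_head orbT.
  by rewrite mem_filter => /andP[].
rewrite /phi_sigma sx; have [s -> Ds] := around_oldE c.
have -> : corner_darts c ++ s = ((c, true) :: [seq (z, false) | z <- a])
    ++ (x, false) :: ([seq (z, false) | z <- b] ++ s).
  by rewrite /corner_darts -/(preds c) Dp map_cat /= -catA.
rewrite next_split /=; first by case: b {Dp} => //=.
rewrite inE xpair_eqE andbF /=; apply/mapP=> -[z za [Dx]].
by move: up; rewrite Dp cat_uniq => /and3P[_ /hasPn/(_ x (mem_head _ _))]; rewrite Dx za.
Qed.

(* The next four lemmas give the predecessor of every half-edge under
   [phi_sigma], and with it the face permutation of the new map. *)
Lemma before_last_pred e : lb (alpha e) = lb e + 1 ->
  S (alpha e, false) = (e, true).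
Proof.
move=> De; have Dp : exists a, preds (phi (alpha e)) = rcons a (alpha e).
  rewrite /preds (orbit_rcons phi_inj) filter_rcons succE /lower first_rec.
  have -> : (lb (alpha e) == lb (alpha e) - 1) = false by lia.
  by rewrite first_rec LM_lab_phi_alpha De addrK !eqxx; eexists.
case: Dp => a Dp; have := @phi_sigma_false (phi (alpha e)) a (alpha e) [::].
by rewrite -cats1 in Dp; move=> ->; rewrite // LM_phi_alpha.
Qed.

Lemma before_no_pred e : lb (alpha e) <= lb e ->
  S (phi (alpha e), true) = (e, true).
Proof.
move=> De; rewrite phi_sigma_true LM_phi_alpha.
case Dp: (preds _) => [//|z s]; have : z \in preds (phi (alpha e)).
  by rewrite Dp mem_head.
rewrite mem_filter => /andP[/eqP]; case: succP => // -[|n] Dn before [Dz] _.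
  by move: Dn => /=; lia.
have := before n (ltnSn n); move: Dz Dn; rewrite /= => /phi_inj ->.
by rewrite LM_lab_phi_alpha => ? ?; lia.
Qed.

Lemma before_first_pred y : lb (phi y) = lb y + 1 ->
  exists2 c, succ (phi y) = Some c & S (c, true) = (phi y, false).
Proof.
move=> Dl; case: succP => [min_y|n Dn before].
  have := min_y (order (@phi m) y).-1.
  by rewrite -iterSr orderSpred iter_order // Dl; lia.
set x := phi y in Dl Dn before *; set c := iter n (@phi m) x.
have sx : succ x = Some c.
  case: (succP x) (Dn) => [/(_ n)|n' Dn' before' _]; first by rewrite Dn; lia.
  congr Some; rewrite /c; case: (ltngtP n n') => [/before'|/before|-> //].
    by rewrite Dn; lia.
  by rewrite Dn'; lia.
exists c => //; rewrite phi_sigma_true.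
suff : first (@phi m) (fun z => succ z == Some c) c = Some x.
  by rewrite /first -/(preds c); case: (preds c) => // ? ? [->].
have cx : fconnect (@phi m) c x by rewrite fconnect_sym // fconnect_iter.
rewrite -(iter_findex cx); apply: some_first; first by rewrite iter_findex // sx.
set a := findex _ _ _ => i lt_ia; apply/eqP.
have a_lt : (a < order (@phi m) c)%N by apply: findex_max.
have Dx : iter a (@phi m) c = x by apply: iter_findex.
have Dy : iter a.-1 (@phi m) c = y.
  by apply: phi_inj; rewrite -iterS prednK ?Dx // (leq_ltn_trans _ lt_ia).
case: succP => // p Dp beforep [Dc]; rewrite -iterD in Dc.
have lab_c : lb c = lb y by rewrite Dn Dl addrK.
(* Suppose an earlier point has successor c. Either the orbit returns to c before x, so that x is
   closer to c than a steps, or y lies between that point and c although its label is already that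
   of c. *)
have [le_pa|lt_ap] := leqP (p + i) a.-1.
  have p_gt0 : (0 < p)%N.
    by rewrite lt0n; apply/eqP=> p0; move: Dp; rewrite p0 /=; lia.
  have Dx' : iter (a - (p + i)) (@phi m) c = x.
    by rewrite -{1}Dc -iterD subnK // (leq_trans le_pa) ?leq_pred.
  have := findex_iter (f := @phi m) (x := c) (i := (a - (p + i))%N).
  rewrite Dx' -/a => H; have := H (leq_ltn_trans (leq_subr _ _) a_lt); lia.
have := beforep (a.-1 - i)%N; rewrite -iterD.
have -> : (a.-1 - i + i)%N = a.-1 by lia.
rewrite -iterD Dc lab_c in Dp; rewrite Dy => H.
by have := H ltac:(lia); lia.
Qed.

Lemma before_pred n w : lb (iter n.+1 (@phi m) w) = lb w ->
  (forall j, (j < n)%N -> lb w < lb (iter j.+1 (@phi m) w)) ->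
  S (w, false) = (iter n.+1 (@phi m) w, false).
Proof.
set x := iter n.+1 _ w => Dx between.
have ge_w j : (j <= n)%N -> lb w <= lb (iter j (@phi m) w).
  by case: j => [|j] // lt_jn; apply/ltW/between.
(* The search from w meets no lower label before x, so it goes on from there. *)
have sxw : succ w = succ x.
  rewrite !succE /lower Dx; have: (n.+1 <= n.+1)%N by [].
  rewrite /x; move: {1 3}(n.+1); elim=> // j IHj lt_jn; rewrite IHj 1?ltnW //.
  rewrite first_rec iterS; case: eqP => // Dj; have := ge_w j lt_jn; lia.
have wx : fconnect (@phi m) w x by apply: fconnect_iter.
case sx: (succ x) => [c|]; last first.
  rewrite /phi_sigma sxw sx /around_new next_map; last 2 first.
  - by move=> ? ? [].
  - exact/filter_uniq/orbit_uniq.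
  congr (_, false); apply: Some_inj; rewrite next_first ?sxw ?sx //.
  rewrite /x iterSr; apply: some_first => [|j lt_jn]; first by rewrite -iterSr sx.
  apply/eqP; rewrite -iterSr => /succ_none/(_ (n - j)%N); rewrite -iterD.
  have -> : (n - j + j.+1 = n.+1)%N by lia.
  by rewrite -/x Dx; have := between j lt_jn; lia.
have lab_c := succ_lab sx; rewrite Dx in lab_c.
have cw : fconnect (@phi m) c w.
  move: sxw; rewrite sx fconnect_sym //; case: (succP w) => // p _ _ [<-].
  exact: fconnect_iter.
set i := findex (@phi m) c w.
have Dw : iter i (@phi m) c = w by apply: iter_findex.
have lt_i : (i < order (@phi m) c)%N by apply: findex_max.
(* The stretch from w to x avoids c, whose label is lower; so the orbit listed from c contains it
   without a break. *)
have lt_in : (i + n.+1 < order (@phi m) c)%N.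
  rewrite ltnNge; apply/negP=> ge_in.
  have Dc : iter (order (@phi m) c - i) (@phi m) w = c.
    by rewrite -Dw -iterD subnK 1?ltnW // iter_order.
  have [eq_n|le_n] := eqVneq (order (@phi m) c - i)%N n.+1.
    by move: lab_c; rewrite -Dc eq_n -/x Dx; lia.
  have := ge_w (order (@phi m) c - i)%N; rewrite Dc lab_c => H.
  by have := H ltac:(lia); lia.
have [r Dr] : exists r, order (@phi m) c = (i + (1 + (n + (1 + r))))%N.
  by exists (order (@phi m) c - (i + n.+1)).-1; lia.
suff Dp : exists a b, preds c = a ++ w :: x :: b.
  by case: Dp => a [b] /phi_sigma_false.
exists [seq z <- traject (@phi m) c i | succ z == Some c].
exists [seq z <- traject (@phi m) (phi x) r | succ z == Some c].
rewrite /preds /orbit Dr !trajectD !filter_cat /= Dw -/x.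
rewrite -[iter n _ (phi w)]iterSr -/x sxw sx eqxx /=; congr (_ ++ _ :: _).
rewrite -[RHS]cat0s; congr (_ ++ _); apply/eqP; rewrite -[_ == _]negbK -has_filter.
apply/hasPn=> z /trajectP[j lt_jn ->]; apply/eqP=> /succ_lab.
by rewrite lab_c -iterSr; have := between j lt_jn; move: (iter j.+1 _ _) => y; lia.
Qed.

End PhiMap.

(** * The new map is a labeled quadrangulation *)

Section PhiQuad.
Variables (g k : nat) (m : labeled_map k).
Hypothesis mLM : is_LM g m.
Implicit Types (e c x y z w : m) (h : phi_dart m) (i : 'I_k).

Notation lb := (@lab k m).
Notation S := (@phi_sigma k m).
Notation q := (phi_pointed m).

Let m_map : is_map m. Proof. by case: mLM => -[]. Qed.
Let sigma_inj : injective (@sigma m) := map_sigma_inj m_map.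
Let alphaK : involutive (@alpha m) := map_alphaK m_map.

Let phi_inj : injective (@phi m).
Proof.
apply: (can_inj (g := fun e => alpha (sigma e))) => e.
by rewrite (LM_sigma_phi mLM) alphaK.
Qed.

(** Walk backwards along the face from x until the label is again at most that of x; since labels
    rise by at most 1 going forwards, it is then equal. *)
Lemma before_exists x : lb x <= lb (alpha (sigma x)) ->
  exists n w, [/\ x = iter n.+1 (@phi m) w, lb x = lb w
    & forall j, (j < n)%N -> lb w < lb (iter j.+1 (@phi m) w)].
Proof.
have Dy : phi (alpha (sigma x)) = x by apply: sigma_inj; rewrite (LM_phi_alpha mLM).
set y := alpha (sigma x) in Dy * => le_xy.
pose f := finv (@phi m); have fK : cancel f (@phi m) := f_finv phi_inj.
have Dfx : f x = y by rewrite /f -Dy finv_f.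
case E: (first f (fun z => lb z <= lb x) y) => [w|]; last first.
  have := first_none E (order f x).-1.
  by rewrite -Dfx -iterSr orderSpred (iter_order (can_inj fK)) lexx.
have [n [Dw le_wx before]] := first_some E.
have iterK p z : iter p (@phi m) (iter p f z) = z.
  by elim: p z => // p IHp z; rewrite iterSr iterS fK IHp.
have Dj j : (j <= n)%N -> iter j (@phi m) w = iter (n - j) f y.
  move=> le_jn; rewrite Dw -{1}(subnKC le_jn) iterD iterK //.
have between j : (j < n)%N -> lb x < lb (iter j.+1 (@phi m) w).
  by move=> lt_jn; rewrite Dj // ltNge; apply: before; lia.
have Dx : x = iter n.+1 (@phi m) w by rewrite iterS Dj // subnn.
have lab_w : lb x = lb w.
  apply/eqP; rewrite eq_le le_wx andbT; case: n Dw between {Dj before E} Dx => [|n] Dw between Dx.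
    by rewrite Dw.
  by have := between 0%N isT; have /andP[_] := LM_lab_step mLM w; rewrite /=; lia.
by exists n, w; split=> // j; rewrite -lab_w; apply: between.
Qed.

(** The origin of [(e, false)] is the successor of e or the added vertex, of label [lb e - 1] in
    both cases. *)
Definition phi_lab h : int := if h.2 then lb h.1 else lb h.1 - 1.

(** Surjectivity on a finite set yields injectivity, after which the preimage is unique and its
    label shows that [phi_lab] is constant around vertices. *)
Lemma phi_sigma_onto h : exists2 h', S h' = h & phi_lab h' = phi_lab h.
Proof.
case: h => x [].
  have [Dl|le_l] := eqVneq (lb (alpha x)) (lb x + 1).
    exists (alpha x, false); first exact: (before_last_pred mLM Dl).
    by rewrite /phi_lab /= Dl addrK.
  exists (phi (alpha x), true); first apply: (before_no_pred mLM).
    have := LM_lab_step mLM x; rewrite (LM_lab_phi mLM) => /andP[_].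
    by move: le_l => /eqP; lia.
  by rewrite /phi_lab /= (LM_lab_phi_alpha mLM).
have Dx : phi (alpha (sigma x)) = x by apply: sigma_inj; rewrite (LM_phi_alpha mLM).
have [le_l|lt_l] := lerP (lb x) (lb (alpha (sigma x))).
  have [n [w [Ex Dl between]]] := before_exists le_l; rewrite Ex in Dl *.
  exists (w, false); first exact: (before_pred mLM Dl between).
  by rewrite /phi_lab /= Dl.
have Dl : lb (phi (alpha (sigma x))) = lb (alpha (sigma x)) + 1.
  by have /andP[_] := LM_lab_step mLM (alpha (sigma x)); rewrite Dx; lia.
have [c sc Sc] := before_first_pred mLM Dl; rewrite Dx in sc Sc.
by exists (c, true) => //; rewrite /phi_lab /= (succ_lab mLM sc).
Qed.

Lemma phi_sigma_inj : injective S.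
Proof.
have [h|S1 S1K] := @fin_all_exists (phi_dart m) (fun _ => phi_dart m) (fun h h' => S h' = h).
  by have [h' Dh _] := phi_sigma_onto h; exists h'.
have S1_inj : injective S1 := can_inj S1K.
have [S2 S12 S21] := injF_bij S1_inj.
have eqS : S =1 S2 by move=> h; rewrite -{1}[h]S21 S1K.
by move=> h h'; rewrite !eqS => /(can_inj S21).
Qed.

Lemma phi_lab_sigma h : phi_lab (S h) = phi_lab h.
Proof. by have [h' /phi_sigma_inj-> ->] := phi_sigma_onto (S h). Qed.

Lemma phi_q_eq h h' : S h' = phi_alpha h -> @phi q h = h'.
Proof. by move=> Dh; rewrite /phi /= -Dh finv_f //; apply: phi_sigma_inj. Qed.

Lemma phi_q_up e : @phi q (e, false) =
  if lb (alpha e) == lb e + 1 then (alpha e, false) else (phi (alpha e), true).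
Proof.
apply: phi_q_eq; case: eqP => [Dl|/eqP ne_l].
  exact: (before_last_pred mLM Dl).
apply: (before_no_pred mLM).
by have /andP[_] := LM_lab_step mLM e; rewrite (LM_lab_phi mLM); lia.
Qed.

Lemma phi_q_pred n w : lb (iter n.+1 (@phi m) w) = lb w ->
  (forall j, (j < n)%N -> lb w < lb (iter j.+1 (@phi m) w)) ->
  @phi q (iter n.+1 (@phi m) w, true) = (w, false).
Proof. by move=> Dl between; apply: phi_q_eq; apply: (before_pred mLM Dl between). Qed.

Lemma phi_q_same e : lb (alpha e) = lb e -> @phi q (phi e, true) = (e, false).
Proof. by move=> De; apply: (@phi_q_pred 0) => //=; rewrite (LM_lab_phi mLM). Qed.

Lemma phi_q_simple e : lb (alpha e) = lb e + 1 -> exists c,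
  [/\ @phi q (e, false) = (alpha e, false), @phi q (alpha e, false) = (phi e, true),
      @phi q (phi e, true) = (c, true) & @phi q (c, true) = (e, false)].
Proof.
move=> Dl; have Dl' : lb (phi e) = lb e + 1 by rewrite (LM_lab_phi mLM).
have [c sc Sc] := before_first_pred mLM Dl'; exists c; split.
- by rewrite phi_q_up Dl eqxx.
- by rewrite phi_q_up alphaK Dl; case: eqP => //; lia.
- exact: phi_q_eq.
move: sc; case: (succP mLM) => // n Dn before [<-]; rewrite -iterSr.
apply: phi_q_pred; first by rewrite iterSr Dn Dl' addrK.
by move=> j /before; rewrite -iterSr Dl'; move: (iter j.+1 _ _) => z; lia.
Qed.

Lemma phi_q_confluent e : lb (alpha e) = lb e ->
  [/\ @phi q (e, false) = (phi (alpha e), true),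
      @phi q (phi (alpha e), true) = (alpha e, false),
      @phi q (alpha e, false) = (phi e, true) & @phi q (phi e, true) = (e, false)].
Proof.
move=> Dl; have ne : (lb e == lb e + 1) = false by lia.
by split; rewrite ?phi_q_up ?alphaK ?Dl ?ne //; apply: phi_q_same; rewrite ?alphaK.
Qed.

Lemma phi_q_face e (u : q := (e, false)) :
  [/\ phi (phi (phi (phi u))) = u, phi (phi u) != u
    & @mate q phi_lab u = (alpha e, false)].
Proof.
have ne_a : alpha e != e by case: m_map => _ _ /(_ e).
have dn b x : @down q phi_lab (x, b) = b.
  by rewrite /down /phi_lab /=; case: b => /=; lia.
have dn' h : @down q phi_lab h = h.2 by case: h => x b; apply: dn.
have := LM_lab_step mLM e; rewrite (LM_lab_phi mLM) => /andP[ge_l le_l]; rewrite /u /mate.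
have [Dl|Dl|Dl] : [\/ lb (alpha e) = lb e + 1, lb (alpha e) = lb e
    | lb (alpha (alpha e)) = lb (alpha e) + 1].
- by rewrite alphaK; case: (ltrgtP (lb (alpha e)) (lb e)) => ?;
    [constructor 3 | constructor 1 | constructor 2]; lia.
- have [c [E1 E2 E3 E4]] := phi_q_simple Dl.
  by rewrite E1 E2 E3 E4 dn xpair_eqE andbF.
- have [E1 E2 E3 E4] := phi_q_confluent Dl.
  by rewrite E1 E2 E3 E4 !dn xpair_eqE (negPf ne_a).
have [c [E1 E2 E3 E4]] := phi_q_simple Dl; rewrite alphaK in E1 E2.
by rewrite E2 E3 E4 E1 !dn xpair_eqE andbF.
Qed.

Lemma phi_lquad : @lquad q phi_lab.
Proof.
have S_inj := phi_sigma_inj.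
have alphaK' : involutive (@alpha q) by case=> x b; rewrite /= /phi_alpha /= negbK.
have phi_q_inj : injective (@phi q).
  by move=> h h' /(congr1 S); rewrite /phi !f_finv // => /(inv_inj alphaK').
have lab_phi h : h.2 -> phi_lab (@phi q h) = phi_lab h - 1.
  case: h => x [] // _; rewrite -phi_lab_sigma /phi f_finv //.
(* A face with descending sides only would lower its label forever. So each face has an ascending
   side, where [phi_q_face] applies, and injectivity of the powers of [phi] carries the result
   back. *)
have up h : exists j e, iter j (@phi q) h = (e, false).
  case E: (first (@phi q) (fun h => ~~ h.2) h) => [[e b]|].
    by have [j [Dj /= b_up _]] := first_some E; exists j, e; rewrite -Dj; case: b b_up {Dj E}.
  have := first_none E => dn.
  have lab_j j : phi_lab (iter j (@phi q) h) = phi_lab h - j%:Z.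
    by elim: j => [|j IHj]; rewrite ?subr0 //= lab_phi ?IHj; [lia | rewrite -[X in is_true X]negbK dn].
  have := lab_j (order (@phi q) h); rewrite (iter_order phi_q_inj) => Dh.
  by have := order_gt0 (@phi q) h; lia.
have iter_inj j : injective (iter j (@phi q)).
  by elim: j => //= j IHj h h' /phi_q_inj/IHj.
split=> //.
- exact: phi_lab_sigma.
- by case=> x []; rewrite /phi_lab /=; [right | left]; lia.
- move=> h; have [j [e De]] := up h; have [F4 _ _] := phi_q_face e.
  by apply: (iter_inj j); rewrite -[X in iter j _ X]/(iter 4 _ h) -iterD addnC iterD De.
move=> h; have [j [e De]] := up h; have [_ F2 _] := phi_q_face e.
apply: contra F2 => /eqP Dh.
by rewrite -De -[X in X == _]/(iter 2 _ _) -iterD addnC iterD /= Dh.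
Qed.

End PhiQuad.

(** * The link between a labeled map and its image *)

Section PhiLinked.
Variables (g k : nat) (m : labeled_map k).
Hypothesis mLM : is_LM g m.
Implicit Types (e c x y z w : m) (h : phi_dart m) (i : 'I_k).

Notation lb := (@lab k m).
Notation S := (@phi_sigma k m).
Notation q := (phi_pointed m).

Let m_map : is_map m. Proof. by case: mLM => -[]. Qed.
Let sigma_inj : injective (@sigma m) := map_sigma_inj m_map.
Let alphaK : involutive (@alpha m) := map_alphaK m_map.
Let lq := phi_lquad mLM.

Let phi_inj : injective (@phi m).
Proof.
apply: (can_inj (g := fun e => alpha (sigma e))) => e.
by rewrite (LM_sigma_phi mLM) alphaK.
Qed.

Lemma phi_down h : @down q (@phi_lab k m) h = h.2.
Proof. by case: h => x b; rewrite /down /phi_lab /=; case: b => /=; lia. Qed.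

(** The half-edges left in the corner of c come from predecessors and ascend; the next corner opens
    with a descending one. *)
Lemma first_pred c a x b : preds c = a ++ x :: b ->
  first S (@down q (@phi_lab k m)) (x, false) = Some (sigma c, true).
Proof.
elim: b a x => [|y b IHb] a x Dp; rewrite first_rec phi_down (phi_sigma_false mLM Dp).
  by rewrite first_rec phi_down.
by apply: (IHb (rcons a x)); rewrite cat_rcons.
Qed.

Lemma phi_first_return c :
  first S (@down q (@phi_lab k m)) (S (c, true)) = Some (sigma c, true).
Proof.
rewrite (phi_sigma_true mLM); case Dp: (preds c) => [|x s].
  by rewrite first_rec phi_down.
exact: (@first_pred c [::] x s).
Qed.

Lemma phi_core_link :
  @core_link q m (@phi_lab k m) lb (fun e => (e, true)) 0.
Proof.
split=> //.
- by move=> e e' [].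
- by move=> e; rewrite phi_down.
- by move=> [e b]; rewrite phi_down /= => ->; exists e.
- by move=> e; rewrite addr0.
- exact: phi_first_return.
by move=> e; have [_ _ ->] := phi_q_face mLM e.
Qed.

Lemma phi_sigma_new x : succ x = None -> exists n,
  [/\ S (x, false) = (iter n.+1 (@phi m) x, false),
      succ (iter n.+1 (@phi m) x) = None
    & forall j, (j < n)%N -> succ (iter j.+1 (@phi m) x) <> None].
Proof.
move=> sx; rewrite /phi_sigma sx /around_new next_map; last 2 first.
- by move=> ? ? [].
- exact/filter_uniq/orbit_uniq.
have := next_first phi_inj (P := fun z => succ z == None) (x := x).
rewrite sx => /(_ isT)/esym/first_some[n [-> /eqP sn before]].
exists n; split=> [||j /before/eqP]; by rewrite iterSr.
Qed.

Lemma phi_org_new z : succ z = None ->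
  org (m := q) (z, false) = [set (x, false) | x in face_of z & succ x == None].
Proof.
move=> sz; apply/setP=> h; rewrite inE; apply/idP/imsetP.
  move/iter_findex <-; elim: (findex _ _ _) => [|n [x]].
    by exists z; rewrite // !inE connect0 sz.
  rewrite !inE => /andP[zx /eqP /[dup] sx /phi_sigma_new[i [Di si _]]] Dx.
  exists (iter i.+1 (@phi m) x); last by rewrite iterS Dx /= -Di.
  by rewrite !inE si eqxx andbT (connect_trans zx) ?fconnect_iter.
case=> x; rewrite !inE => /andP[/iter_findex <- /eqP + ->].
move: (findex _ _ _) => n; elim/ltn_ind: n z sz => -[|n] IHn z sz sn.
  exact: connect0.
have [i [Di si before]] := phi_sigma_new sz.
have le_in : (i <= n)%N by rewrite leqNgt; apply/negP=> /before.
apply: connect_trans (fconnect1 _ _) _.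
have -> : @sigma q (z, false) = (iter i.+1 (@phi m) z, false) by [].
have Dn : n.+1 = (n - i + i.+1)%N by lia.
by rewrite Dn iterD in sn *; apply: IHn => //; lia.
Qed.

Lemma phi_fac_face i : exists2 z, succ z = None & fac m i = face_of z.
Proof.
have : fac m i \in faces m by case: mLM => _ _ <- _; apply: imset_f.
case/imsetP=> e _ ->; have [z ez min_z] := face_minimal_exists e.
exists z; first exact/(succ_none mLM).
by apply/eqP; rewrite (face_eq _ _ phi_inj) inE.
Qed.

Lemma fac_cover e : exists2 i, fac m i = face_of e & e \in fac m i.
Proof.
have : face_of e \in faces m by apply: imset_f.
case: mLM => _ _ <- _ /imsetP[i _ Di]; exists i; first by rewrite -Di.
by rewrite -Di inE connect0.
Qed.

Lemma in_phi_src i x b :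
  ((x, b) \in phi_src m i) = [&& ~~ b, x \in fac m i & succ x == None].
Proof.
apply/imsetP/and3P => [[y]|[/negPf-> xi sx]]; last by exists x; rewrite // inE xi.
by rewrite inE => /andP[yi sy] [-> ->].
Qed.

Lemma phi_linked : @linked k q m (@phi_lab k m) (fun e => (e, true)) 0.
Proof.
split=> /=; first exact: phi_core_link.
- move=> i; have [z sz Dz] := phi_fac_face i; exists (z, false).
  by rewrite phi_org_new // /phi_src Dz.
- move=> i j Dij; have [z sz Dz] := phi_fac_face i.
  have := in_phi_src i z false; rewrite {1}Dz inE connect0 sz eqxx /= => zi.
  move: zi; rewrite Dij in_phi_src => /and3P[_ zj _].
  case: mLM => _ fac_inj Dfac _; apply: fac_inj.
  have : fac m j \in faces m by rewrite -Dfac; apply: imset_f.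
  case/imsetP=> y _ Dy; rewrite Dz Dy; apply/eqP; rewrite eq_sym.
  by rewrite (face_eq _ _ phi_inj) -Dy.
- move=> [x b]; split=> [[i]|up].
    rewrite in_phi_src => /and3P[/negPf-> _ /eqP sx] y; rewrite phi_down.
    move=> xy; have : y \in org (m := q) (x, false) by rewrite inE.
    by rewrite phi_org_new // => /imsetP[z _ ->].
  have := up (x, b) (connect0 _ _); rewrite phi_down /= => /negPf Db.
  rewrite {}Db in up *; have [i _ xi] := fac_cover x; exists i.
  rewrite in_phi_src xi /=; case sx: (succ x) => [c|] //.
  (* With a successor c, the origin of [(x, false)] would be a vertex of m, from which some
     half-edge descends. *)
  have xc : x \in preds c.
    rewrite mem_filter sx eqxx -fconnect_orbit fconnect_sym //.
    by case: (succP mLM) sx => // n _ _ [<-]; apply: fconnect_iter.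
  have [a [s Dp]] : exists a s, preds c = a ++ x :: s.
    by case/splitPr: xc => a s; exists a, s.
  by have := up _ (first_fconnect (first_pred Dp)); rewrite phi_down.
- move=> i [x b]; rewrite in_phi_src => /and3P[/negPf-> xi /eqP sx].
  have [z _ Dz] := phi_fac_face i; rewrite Dz inE in xi.
  rewrite /phi_lab /phi_delay /= Dz; congr (_ - 1).
  have /eqP -> : face_of z == face_of x by rewrite (face_eq _ _ phi_inj) inE.
  by rewrite face_minimal_min //; apply/(succ_none mLM).
move=> i e; have [z sz Dz] := phi_fac_face i; rewrite Dz inE; split=> [ze|[x [ex]]].
  exists z; rewrite fconnect_sym // ze; split=> //.
  by rewrite in_phi_src Dz inE connect0 sz eqxx.
rewrite in_phi_src Dz inE /= => /andP[zx _].
by rewrite fconnect_sym // in ex; apply: connect_trans zx ex.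
Qed.

End PhiLinked.

(** * The theorem *)

Section Sectors.
Variables (k : nat) (q : pointed_map k) (m : labeled_map k).
Variables (t : m -> q) (c : int).
Hypotheses (hk : (0 < k)%N) (lk : linked (@elabel k q) t c).
Implicit Types (e z : m) (x y : q) (i : 'I_k).

Let cl := lk_core lk.
Let lq := cl_quad cl.

Lemma lstepE x y : lstep x y = (descent (@elabel k q) x == Some y).
Proof.
rewrite /lstep /descent /first; congr (ohead _ == _).
by apply: eq_filter => z; rewrite inE.
Qed.

Lemma lstep_face e y : connect (@lstep k q) (t e) y ->
  exists2 z, fconnect (@phi m) e z & y = t z.
Proof.
have: exists2 z, fconnect (@phi m) e z & t e = t z by exists e.
move=> + cy; move: (t e) y cy; apply: connect_sub_rel => [//|x1 x2 x3 H1 H2 /H1/H2 //|].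
move=> x y; rewrite lstepE => /eqP + [z ez Dx]; rewrite Dx.
move=> /(descent_face cl)[z' zz' Dy].
by exists z' => //; apply: connect_trans ez zz'.
Qed.

(** By induction on the height n above the minimum of the face: a step of the leftmost path stays in
    the face and lowers the label by 1. The edge from a minimal corner to the source accounts for
    the length [n.+1]. *)
Lemma descending_walk i n z0 e : face_minimal (@lab k m) z0 ->
  alpha (t z0) \in src q i -> e \in fac m i -> lab e = lab z0 + n%:Z ->
  exists z, [/\ connect (@lstep k q) (t e) (t z), descent (@elabel k q) (t z) = None,
    alpha (t z) \in src q i & walk n.+1 (org (t e)) (src q i)].
Proof.
move=> min_z0 zi; have Dfac := fac_face lk (src_fac lk zi).
have phi_sym := fconnect_sym (cl_phi_inj cl).
elim: n e => [|n IHn] e ei De; have := ei; rewrite Dfac inE => z0e.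
  have min_e : face_minimal (@lab k m) e.
    move=> p; rewrite De addr0; rewrite -(iter_findex z0e) -iterD; exact: min_z0.
  have eis := fac_src lk min_e ei.
  exists e; split=> //; first by apply/(face_minimalP cl).
  by rewrite (src_org lk eis); apply: walk_edge.
case E: (descent (@elabel k q) (t e)) => [y|]; last first.
  have min_e := proj2 (face_minimalP cl e) E.
  by have := minimal_same_lab lk min_z0 min_e z0e; rewrite De; lia.
have := E; case: (descentP cl e) => // p Dp _ [Dy]; set z' := iter p _ e in Dp Dy.
have z'i : z' \in fac m i.
  by rewrite Dfac inE; apply: connect_trans z0e (fconnect_iter _ _ _).
have Dz' : lab z' = lab z0 + n%:Z by rewrite Dp De; lia.
have [z [cz nz zsrc wz]] := IHn _ z'i Dz'; exists z; split=> //.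
  by apply: connect_trans cz; apply: connect1; rewrite lstepE E Dy.
rewrite -add1n; apply: walk_cat (walk_edge _) _.
suff -> : org (alpha (t e)) = org (t z') by [].
apply/eqP; rewrite (org_eq _ _ (lq_sigma lq)) inE -(same_fconnect_finv (lq_sigma lq)).
by rewrite Dy; apply: first_fconnect E.
Qed.

Lemma EiP i x : reflect (exists2 e, e \in fac m i & x = t e) (x \in Ei q i).
Proof.
apply: (iffP idP) => [|[e ei ->]].
  rewrite !inE => /andP[dx /existsP[y /and3P[cxy _ /eqP Dy]]].
  have [e De] := cl_onto cl dx; exists e => //.
  rewrite -De in cxy; have [z ez Dz] := lstep_face cxy.
  by apply/(lk_fac lk); exists z; rewrite -Dy /tgt Dz org_in.
have [z0 min_z0 zi] := src_minimal_exists lk i.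
have le_e : lab z0 <= lab e.
  have := ei; rewrite (fac_face lk (src_fac lk zi)) inE => /iter_findex <-.
  exact: min_z0.
have [|z [cz nz zsrc _]] := descending_walk (n := `|lab e - lab z0|) min_z0 zi ei.
  by lia.
rewrite inE inE; apply/andP; split; first exact: (cl_down cl).
apply/existsP; exists (t z); rewrite cz /tgt (src_org lk zsrc) eqxx andbT /=.
by apply/existsP=> -[y]; rewrite lstepE nz.
Qed.

Lemma Ei_imset i : Ei q i = t @: fac m i.
Proof.
by apply/setP=> x; apply/EiP/imsetP => -[e ei ->]; exists e.
Qed.

(** The leftmost path bounds the distance from above, and the label of q, a minimum over all
    sources, bounds it from below. *)
Lemma dist_fac i e : e \in fac m i ->
  (dist (org (t e)) (src q i))%:Z = lab e - face_min (fac m i) + 1.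
Proof.
move=> ei; have [z0 min_z0 zi] := src_minimal_exists lk i.
have Dfac := fac_face lk (src_fac lk zi).
have le_e : lab z0 <= lab e.
  by have := ei; rewrite Dfac inE => /iter_findex <-; apply: min_z0.
rewrite Dfac (face_minimal_min min_z0).
have [|z [_ _ _ wz]] := descending_walk (n := `|lab e - lab z0|) min_z0 zi ei.
  by lia.
have := dist_le (org_vertices _) wz; have := vlabel_le i (org (t e)).
have := lk_delay lk zi; rewrite (l_alpha_t cl) => <-.
by have := cl_lab cl e; rewrite /elabel => ->; lia.
Qed.

Lemma card_sector i (d : nat) :
  #|[set x in Ei q i | dist (org x) (src q i) == d]| =
  #|[set e in fac m i | lab e - face_min (fac m i) + 1 == d%:Z]|.
Proof.
rewrite -(card_imset _ (cl_inj cl)); apply: eq_card => x.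
rewrite inE Ei_imset; apply/andP/imsetP => [[/imsetP[e ei ->] De]|[e + ->]].
  by exists e; rewrite // inE ei -dist_fac.
by rewrite inE => /andP[ei De]; split; [apply: imset_f | rewrite -dist_fac in De].
Qed.

End Sectors.

(** * Independence of representatives *)

Section Classes.
Variables g k : nat.
Implicit Types (q : pointed_map k) (m : labeled_map k).

Lemma pointed_iso_class q q' m l l' t t' c c' :
  @linked k q m l t c -> @linked k q' m l' t' c' -> pointed_iso q = pointed_iso q'.
Proof.
move=> lk lk'; apply: boolp.funext => p; apply: boolp.propext; split=> iso_p.
  have [s [u [d lk_p]]] := linked_iso_pointed lk iso_p.
  exact: linked_pointed_iso lk' lk_p.
have [s [u [d lk_p]]] := linked_iso_pointed lk' iso_p.
exact: linked_pointed_iso lk lk_p.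
Qed.

Lemma labeled_iso_class q m m' l l' t t' c c' :
  @linked k q m l t c -> @linked k q m' l' t' c' -> labeled_iso m = labeled_iso m'.
Proof.
move=> lk lk'; apply: boolp.funext => p; apply: boolp.propext; split=> iso_p.
  have [u [d lk_p]] := linked_iso_labeled lk iso_p.
  exact: linked_labeled_iso lk' lk_p.
have [u [d lk_p]] := linked_iso_labeled lk' iso_p.
exact: linked_labeled_iso lk lk_p.
Qed.

Lemma linked_is_Q q m l t c : @linked k q m l t c -> is_LM g m -> is_Q g q.
Proof.
by move=> lk [m_g _ _ _]; apply/(linked_Q lk)/(linked_map_of_genus lk).
Qed.

Lemma linked_is_LM q m l t c : @linked k q m l t c -> is_Q g q -> is_LM g m.
Proof. by move=> lk [q_g _ _ _]; apply: (linked_LM lk). Qed.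

Lemma psi_LM q : (0 < k)%N -> is_Q g q -> is_LM g (psi q).
Proof. by move=> hk qQ; apply: linked_is_LM (psi_linked hk qQ) qQ. Qed.

Lemma phi_Q m : is_LM g m -> is_Q g (phi_pointed m).
Proof. by move=> mLM; apply: linked_is_Q (phi_linked mLM) mLM. Qed.

(** Instead of transporting each condition, q' inherits a link to [psi q], and a link to an element
    of [is_LM] implies them all. *)
Lemma pointed_iso_Q q q' : (0 < k)%N -> is_Q g q -> pointed_iso q q' -> is_Q g q'.
Proof.
move=> hk qQ /(linked_iso_pointed (psi_linked hk qQ))[l [t [c lk]]].
exact: linked_is_Q lk (psi_LM hk qQ).
Qed.

Lemma labeled_iso_LM m m' : is_LM g m -> labeled_iso m m' -> is_LM g m'.
Proof.
move=> mLM /(linked_iso_labeled (phi_linked mLM))[t [c lk]].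
exact: linked_is_LM lk (phi_Q mLM).
Qed.

Lemma Psio_iso q : (0 < k)%N -> is_Q g q -> Psio (pointed_iso q) = labeled_iso (psi q).
Proof.
move=> hk qQ; apply: boolp.funext => m; apply: boolp.propext; split=> [[q' qq' iso_m]|].
  have lk' := psi_linked hk (pointed_iso_Q hk qQ qq').
  have [l [t [c lk]]] := linked_iso_pointed (psi_linked hk qQ) qq'.
  by rewrite (labeled_iso_class lk lk').
by exists q => //; apply: pointed_iso_refl.
Qed.

Lemma Phio_iso m : is_LM g m -> Phio (labeled_iso m) = pointed_iso (phi_pointed m).
Proof.
move=> mLM; apply: boolp.funext => q; apply: boolp.propext; split=> [[m' mm' iso_q]|].
  have lk' := phi_linked (labeled_iso_LM mLM mm').
  have [t [c lk]] := linked_iso_labeled (phi_linked mLM) mm'.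
  by rewrite (pointed_iso_class lk lk').
by exists m => //; apply: labeled_iso_refl.
Qed.

End Classes.

Lemma Psio_class (g k : nat) (hk : (0 < k)%N) (A : Qo g k) :
  exists2 m, is_LM g m & Psio (sval A) = labeled_iso m.
Proof.
by case: A => /= _ [q qQ ->]; exists (psi q); [apply: psi_LM | apply: Psio_iso qQ].
Qed.

Lemma Phio_class (g k : nat) (B : LMo g k) :
  exists2 q, is_Q g q & Phio (sval B) = pointed_iso q.
Proof.
by case: B => /= _ [m mLM ->]; exists (phi_pointed m); [apply: phi_Q | apply: Phio_iso mLM].
Qed.

Theorem theorem4 (g k : nat) (hk : (0 < k)%N) :
  exists (Psi : Qo g k -> LMo g k) (Phi : LMo g k -> Qo g k),
  [/\ forall A, sval (Psi A) = Psio (sval A),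
      forall B, sval (Phi B) = Phio (sval B),
      cancel Psi Phi /\ cancel Phi Psi,
      bijective Psi /\ bijective Phi
    & forall (A : Qo g k) (q : pointed_map k) (m : labeled_map k),
        sval A q -> sval (Psi A) m ->
        [/\ [/\ (#|edges q| = 2 * #|faces q|)%N,
                #|faces q| = #|edges m|
              & forall i : 'I_k, #|Ei q i| = #|fac m i|],
            #|vertices q| = (#|vertices m| + k)%N
          & forall (i : 'I_k) (d : nat), (1 <= d)%N ->
              #|[set e in Ei q i | dist (org e) (src q i) == d]| =
              #|[set e in fac m i |
                   lab e - face_min (fac m i) + 1 == d%:Z]|]].
Proof.
pose Psi A : LMo g k := exist _ (Psio (sval A)) (Psio_class hk A).
pose Phi B : Qo g k := exist _ (Phio (sval B)) (Phio_class B).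
have PsiK : cancel Psi Phi.
  case=> A [q qQ DA]; apply: boolp.eq_exist; rewrite /= DA.
  rewrite (Psio_iso hk qQ) (Phio_iso (psi_LM hk qQ)).
  exact: pointed_iso_class (phi_linked (psi_LM hk qQ)) (psi_linked hk qQ).
have PhiK : cancel Phi Psi.
  case=> B [m mLM DB]; apply: boolp.eq_exist; rewrite /= DB.
  rewrite (Phio_iso mLM) (Psio_iso hk (phi_Q mLM)).
  exact: labeled_iso_class (psi_linked hk (phi_Q mLM)) (phi_linked mLM).
exists Psi, Phi; split=> //; first by split; [exists Phi | exists Psi].
case=> A [q0 q0Q DA] q m; rewrite /= DA => q0q; rewrite (Psio_iso hk q0Q) => q0m.
have qQ := pointed_iso_Q hk q0Q q0q; have lkq := psi_linked hk qQ.
(* The given q need not be the chosen q0: [psi q0] and [psi q] are both linked to q, hence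
   isomorphic, and m inherits a link to q with the labels [elabel]. *)
have [l0 [t0 [c0 lk0]]] := linked_iso_pointed (psi_linked hk q0Q) q0q.
rewrite (labeled_iso_class lk0 lkq) in q0m.
have [t [c lk]] := linked_iso_labeled lkq q0m.
have [E_F F_E] := card_edges_link lk.
split=> [||i d _]; first split=> // i.
- by rewrite (Ei_imset hk lk) (card_imset _ (cl_inj (lk_core lk))).
- exact: card_vertices_linked lk.
exact: (card_sector hk lk).
Qed.
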